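(* Assume in addition that $l$ is $\mu$-strongly convex on $\mathcal{X}$ for some $\mu>0$. Consider SPDHG (as in the context) run with step-sizes $\beta^{k+1} = \frac{2}{\mu(k+2)+2L}$ and non-uniform weights $\alpha^{k+1}=\frac{2(k+1)}{(t+1)(t+2)}$, $k=0,\dots,t$. Let $(y^*,x^* )$ be any saddle point of $\min_{x\in\mathcal{X}}\max_{y\in\mathcal{Y}}P(y,x)$. Then for every $\Omega>0$ and $t\ge0$, $$\mathrm{Prob}\left(P(y^*,\bar{x}^t) - P(\bar{y}^t,x^* ) > \frac{D_y^2}{s(t+2)} + \frac{L D_x^2}{t+2} + \frac{4\lambda_{\max}(F^\top F)D_y^2}{\mu(t+2)} + \frac{2\sqrt{2\Omega} D_x \sigma}{\sqrt{t+2}} + \frac{4(1+\Omega) \sigma^2}{\mu(t+2)}\right) \leq 2\exp(-\Omega).$$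
   Context: Setting: $\mathcal{X}\subset\mathbb{R}^d$ is a nonempty convex compact set with diameter $D_x$ (so $\|x-x'\|\le D_x$ for all $x,x'\in\mathcal{X}$), $\mathcal{Y}\subset\mathbb{R}^l$ is a nonempty convex compact set with diameter $D_y$, $F\in\mathbb{R}^{l\times d}$, and $\lambda_{\max}(F^\top F)$ denotes the largest eigenvalue of $F^\top F$. The loss is $l(x)=\mathbb{E}_\xi[l(x,\xi)]$, a convex, continuously differentiable function on $\mathcal{X}$ with $L$-Lipschitz gradient: $\|\nabla l(x_1)-\nabla l(x_2)\|\le L\|x_1-x_2\|$ for all $x_1,x_2\in\mathcal{X}$. $\mu$-strong convexity means $l(y)-l(x)-(y-x)^\top\nabla l(x)\ge\frac{\mu}{2}\|y-x\|^2$ for all $x,y\in\mathcal{X}$. The stochastic gradient $\nabla l(x,\xi)$ satisfies, for every $x\in\mathcal{X}$: $\mathbb{E}[\nabla l(x,\xi)]=\nabla l(x)$, $\mathbb{E}\|\nabla l(x,\xi)-\nabla l(x)\|^2\le\sigma^2$, and $\mathbb{E}\exp\left(\|\nabla l(x,\xi)-\nabla l(x)\|^2/\sigma^2\right)\le \exp(1)$, for a constant $\sigma>0$. The saddle function is $P(y,x)=l(x)+\langle y,Fx\rangle$ for $x\in\mathcal{X},y\in\mathcal{Y}$; a saddle point $(y^*,x^* )$ satisfies $P(y,x^* )\le P(y^*,x^* )\le P(y^*,x)$ for all $(y,x)\in\mathcal{Y}\times\mathcal{X}$ (assumed to exist). SPDHG: fix $s>0$, $x^0\in\mathcal{X}$,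 $y^0\in\mathcal{Y}$, and a sequence of step-sizes $\beta^{k+1}>0$. For $k=0,1,2,\dots$, draw a sample $\xi^{k+1}$ independently of the past (i.i.d. samples), and set $$y^{k+1}=\arg\max_{y\in\mathcal{Y}}\Big\{P(y,x^k)-\tfrac{1}{2s}\|y-y^k\|^2\Big\},\qquad x^{k+1}=\Pi_{\mathcal{X}}\Big[x^k-\beta^{k+1}\big(\nabla l(x^k,\xi^{k+1})+F^\top y^{k+1}\big)\Big],$$ where $\Pi_{\mathcal{X}}$ is Euclidean projection onto $\mathcal{X}$. Given weights $\alpha^{k+1}\ge0$ with $\sum_{k=0}^t\alpha^{k+1}=1$, the output after $t$ steps is $\bar x^t=\sum_{k=0}^t\alpha^{k+1}x^{k+1}$, $\bar y^t=\sum_{k=0}^t\alpha^{k+1}y^{k+1}$. *)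

(* Defs.v *)
From HB Require Import structures.
From mathcomp Require Import all_boot all_order all_algebra.
From mathcomp Require Import all_classical all_reals all_analysis.
Set Implicit Arguments. Unset Strict Implicit. Unset Printing Implicit Defensive.
Import Order.TTheory GRing.Theory Num.Theory.
Import numFieldNormedType.Exports.
Local Open Scope classical_set_scope.
Local Open Scope ring_scope.

Definition dotv {R : realType} {n : nat} (u v : 'cV[R]_n) : R :=
  \sum_(i < n) u i 0 * v i 0.
Definition enorm {R : realType} {n : nat} (u : 'cV[R]_n) : R :=
  Num.sqrt (dotv u u).

Definition convex_set_cv {R : realType} {n : nat} (A : set 'cV[R]_n) : Prop :=
  forall x y, A x -> A y -> forall t : R, 0 <= t <= 1 ->
    A (t *: x + (1 - t) *: y).

Definition is_diameter {R : realType} {n : nat} (A : set 'cV[R]_n) (D : R) : Prop :=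
  (forall x y, A x -> A y -> enorm (x - y) <= D) /\
  (forall E, (forall x y, A x -> A y -> enorm (x - y) <= E) -> D <= E).

Definition convex_fun_on {R : realType} {n : nat} (A : set 'cV[R]_n)
  (f : 'cV[R]_n -> R) : Prop :=
  forall x y, A x -> A y -> forall t : R, 0 <= t <= 1 ->
    f (t *: x + (1 - t) *: y) <= t * f x + (1 - t) * f y.

Definition gradient_on {R : realType} {n : nat} (A : set 'cV[R]_n)
  (f : 'cV[R]_n -> R) (g : 'cV[R]_n -> 'cV[R]_n) : Prop :=
  forall x, A x -> differentiable f x /\ forall h, 'd f x h = dotv (g x) h.

Definition grad_lipschitz_on {R : realType} {n : nat} (A : set 'cV[R]_n)
  (g : 'cV[R]_n -> 'cV[R]_n) (L : R) : Prop :=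
  forall x1 x2, A x1 -> A x2 -> enorm (g x1 - g x2) <= L * enorm (x1 - x2).

Definition strongly_convex_on {R : realType} {n : nat} (A : set 'cV[R]_n)
  (f : 'cV[R]_n -> R) (g : 'cV[R]_n -> 'cV[R]_n) (mu : R) : Prop :=
  forall x y, A x -> A y ->
    f y - f x - dotv (y - x) (g x) >= mu / 2 * enorm (y - x) ^+ 2.

Definition is_lambda_max {R : realType} {n : nat} (M : 'M[R]_n) (lam : R) : Prop :=
  eigenvalue M lam /\ forall a, eigenvalue M a -> a <= lam.

Definition saddleP {R : realType} {d l : nat} (lf : 'cV[R]_d -> R)
  (F : 'M[R]_(l, d)) (y : 'cV[R]_l) (x : 'cV[R]_d) : R :=
  lf x + dotv y (F *m x).

Definition is_saddle_point {R : realType} {d l : nat} (X : set 'cV[R]_d)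
  (Y : set 'cV[R]_l) (Pf : 'cV[R]_l -> 'cV[R]_d -> R) ys xs : Prop :=
  Y ys /\ X xs /\
  (forall y, Y y -> Pf y xs <= Pf ys xs) /\ (forall x, X x -> Pf ys xs <= Pf ys x).

Definition mutually_independent {R : realType} {dO dX : measure_display}
  {Om : measurableType dO} {Xi : measurableType dX}
  (P : probability Om R) (xi : nat -> Om -> Xi) : Prop :=
  forall (I : seq nat) (A : nat -> set Xi), uniq I ->
    (forall i, i \in I -> measurable (A i)) ->
    P (\bigcap_(i in [set j | j \in I]) (xi i @^-1` A i)) =
      (\prod_(i <- I) P (xi i @^-1` A i))%E.

Definition identically_distributed {R : realType} {dO dX : measure_display}
  {Om : measurableType dO} {Xi : measurableType dX}
  (P : probability Om R) (xi : nat -> Om -> Xi) (mu : probability Xi R) : Prop :=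
  forall k, measurable_fun setT (xi k) /\
    forall A, measurable A -> P (xi k @^-1` A) = mu A.

(* Main.v *)
Require Import Defs.
From HB Require Import structures.
From mathcomp Require Import all_boot all_order all_algebra.
From mathcomp Require Import all_classical all_reals all_analysis.
From mathcomp Require Import measurable_realfun ring lra.
Import Order.TTheory GRing.Theory Num.Theory.
Import numFieldNormedType.Exports.
Local Open Scope classical_set_scope.
Local Open Scope ring_scope.

(** Let [c_k = mu * (k + 2)], so that [1 / beta_k = c_k / 2 + L].  The optimality
    of the two projections, the descent lemma and strong convexity bound the gap at
    step [k] by terms which, weighted by [k + 1], telescope up to [L / 2] times the
    squared distance to [xs], plus the error
    [dotv zeta (xs - x) + 2 * (lam * Dy ^ 2 + |zeta| ^ 2) / c_k], where [zeta] is the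
    gradient noise.  The martingale part is controlled by the moment bound
    [E exp (th * u) <= exp (th ^ 2 * c ^ 2)], obtained from [exp u <= u + exp (u ^ 2)]
    when [th * c <= 1] and from AM-GM otherwise, and the sum of [|zeta| ^ 2] by
    convexity of [exp]; Markov's inequality gives [exp (- Omega)] for each part.
    Conditioning on the past at time [k] is Fubini's theorem on
    [(Om, sigma (xi 0, .., xi (k - 1))) * Xi], where the law of [(w, xi k w)] is a
    product measure. *)

Set Implicit Arguments.
Unset Strict Implicit.
Unset Printing Implicit Defensive.

(** * Euclidean geometry *)

(** The noise is paired with [xs - x k] and not with [xs - x k.+1], because the former depends on
    past samples only; this is what makes the weighted sum a martingale. The difference
    [dotv zeta (x k - x k.+1)], and the mismatch due to the dual step being taken at [x k], are both
    paid by the term [- c_k / 4 * |x k.+1 - x k| ^ 2], which is what remains once the descent lemma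
    has consumed the part [L] of [1 / beta_k]. The weight [k + 1] comes from the identity [(k + 1) *
    (mu * (k + 2) / 4 - mu / 2) = k * (mu * (k + 1) / 4)]. Two obstacles shape the probabilistic
    part. The iterates are given only pointwise, as minimizers, so their measurability has to be
    derived from uniqueness and nonexpansiveness of projections. The estimates on [lf] and [gl] hold
    on [X] only, so these functions are composed with the projection onto [X] before continuity is
    invoked. *)

Lemma dotvC (R : realType) n (u v : 'cV[R]_n) : dotv u v = dotv v u.
Proof. by apply: eq_bigr => i _; rewrite mulrC. Qed.

Lemma dotvDl (R : realType) n (u v w : 'cV[R]_n) :
  dotv (u + v) w = dotv u w + dotv v w.
Proof.
by rewrite /dotv -big_split; apply: eq_bigr => i _; rewrite mxE mulrDl.
Qed.

Lemma dotvZl (R : realType) n (a : R) (u w : 'cV[R]_n) :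
  dotv (a *: u) w = a * dotv u w.
Proof.
by rewrite /dotv mulr_sumr; apply: eq_bigr => i _; rewrite mxE -mulrA.
Qed.

Lemma dotvNl (R : realType) n (u w : 'cV[R]_n) : dotv (- u) w = - dotv u w.
Proof. by rewrite -scaleN1r dotvZl mulN1r. Qed.

Lemma dotvDr (R : realType) n (u v w : 'cV[R]_n) :
  dotv w (u + v) = dotv w u + dotv w v.
Proof. by rewrite dotvC dotvDl !(dotvC w). Qed.

Lemma dotvZr (R : realType) n (a : R) (u w : 'cV[R]_n) :
  dotv w (a *: u) = a * dotv w u.
Proof. by rewrite dotvC dotvZl (dotvC w). Qed.

Lemma dotvNr (R : realType) n (u w : 'cV[R]_n) : dotv w (- u) = - dotv w u.
Proof. by rewrite dotvC dotvNl (dotvC w). Qed.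

Definition dotvE := (dotvDl, dotvDr, dotvNl, dotvNr, dotvZl, dotvZr).

Lemma dotv_suml (R : realType) n m (u : 'I_m -> 'cV[R]_n) (w : 'cV[R]_n) :
  dotv (\sum_k u k) w = \sum_k dotv (u k) w.
Proof.
elim/big_rec2: _ => [|k a b _ <-]; last by rewrite dotvDl.
by rewrite -(scale0r (0 : 'cV[R]_n)) dotvZl mul0r.
Qed.

Lemma dotv_mulmxr (R : realType) m n (F : 'M[R]_(m, n)) (u : 'cV[R]_m)
  (v : 'cV[R]_n) : dotv u (F *m v) = dotv (F^T *m u) v.
Proof.
rewrite /dotv.
transitivity (\sum_i \sum_j u i 0 * F i j * v j 0).
  by apply: eq_bigr => i _; rewrite mxE mulr_sumr; apply: eq_bigr => j _; rewrite mulrA.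
rewrite exchange_big; apply: eq_bigr => j _.
by rewrite mxE mulr_suml; apply: eq_bigr => i _; rewrite !mxE (mulrC (u i 0)).
Qed.

Lemma dotv_ge0 (R : realType) n (u : 'cV[R]_n) : 0 <= dotv u u.
Proof. by apply: sumr_ge0 => i _; rewrite -expr2 sqr_ge0. Qed.

Lemma dotv_eq0 (R : realType) n (u : 'cV[R]_n) : dotv u u = 0 -> u = 0.
Proof.
move=> /eqP; rewrite psumr_eq0 => [/allP u0|i _]; last by rewrite -expr2 sqr_ge0.
apply/matrixP => i j; rewrite mxE ord1.
by have := u0 i; rewrite mem_index_enum -expr2 sqrf_eq0 => /(_ isT) /eqP.
Qed.

Lemma enorm_ge0 (R : realType) n (u : 'cV[R]_n) : 0 <= enorm u.
Proof. exact: sqrtr_ge0. Qed.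

Lemma enorm_sqr (R : realType) n (u : 'cV[R]_n) : enorm u ^+ 2 = dotv u u.
Proof. by rewrite sqr_sqrtr ?dotv_ge0. Qed.

Lemma enorm_le (R : realType) n m (u : 'cV[R]_n) (v : 'cV[R]_m) :
  (enorm u <= enorm v) = (dotv u u <= dotv v v).
Proof. by rewrite ler_sqrt ?dotv_ge0. Qed.

Lemma enorm_leP (R : realType) n (u : 'cV[R]_n) (c : R) : 0 <= c ->
  (enorm u <= c) = (dotv u u <= c ^+ 2).
Proof.
by move=> c0; rewrite -enorm_sqr ler_pXn2r ?nnegrE ?enorm_ge0.
Qed.

Lemma enormN (R : realType) n (u : 'cV[R]_n) : enorm (- u) = enorm u.
Proof. by rewrite /enorm !dotvE opprK. Qed.

Lemma enormZ (R : realType) n (a : R) (u : 'cV[R]_n) : enorm (a *: u) = `|a| * enorm u.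
Proof. by rewrite /enorm !dotvE mulrA -expr2 sqrtrM ?sqr_ge0// sqrtr_sqr. Qed.

Lemma enorm0 (R : realType) n : enorm (0 : 'cV[R]_n) = 0.
Proof. by rewrite -(scale0r (0 : 'cV[R]_n)) enormZ normr0 mul0r. Qed.

Lemma CauchySchwarz_dotv (R : realType) n (u v : 'cV[R]_n) :
  dotv u v <= enorm u * enorm v.
Proof.
have [->|v0] := eqVneq v 0.
  by rewrite -(scale0r (0 : 'cV[R]_n)) dotvZr enormZ normr0 !mul0r mulr0.
have vv : 0 < dotv v v.
  by rewrite lt_neqAle dotv_ge0 andbT eq_sym; apply: contra_neq v0 => /dotv_eq0.
have h := dotv_ge0 (dotv v v *: u - dotv u v *: v).
move: h; rewrite !dotvE (dotvC v u) => h.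
have {}h : (dotv u v) ^+ 2 <= dotv u u * dotv v v.
  have : 0 <= dotv v v * (dotv u u * dotv v v - dotv u v ^+ 2) by nra.
  by rewrite pmulr_rge0// subr_ge0.
rewrite (le_trans (ler_norm _))// /enorm -sqrtrM ?dotv_ge0//.
by rewrite -sqrtr_sqr ler_sqrt// mulr_ge0 ?dotv_ge0.
Qed.

Lemma dotv_norm_le (R : realType) n (u v : 'cV[R]_n) :
  `|dotv u v| <= enorm u * enorm v.
Proof.
rewrite ler_norml CauchySchwarz_dotv andbT lerNl -dotvNl.
by rewrite (le_trans (CauchySchwarz_dotv _ _))// enormN.
Qed.

Lemma enorm_triangle (R : realType) n (u v : 'cV[R]_n) :
  enorm (u + v) <= enorm u + enorm v.
Proof.
rewrite enorm_leP ?addr_ge0 ?enorm_ge0// !dotvE (dotvC v u) -!enorm_sqr.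
have := CauchySchwarz_dotv u v; nra.
Qed.

Lemma coord_le_enorm (R : realType) n (u : 'cV[R]_n) i : `|u i 0| <= enorm u.
Proof.
rewrite -sqrtr_sqr ler_sqrt ?dotv_ge0// /dotv (bigD1 i)//= -expr2 lerDl.
by apply: sumr_ge0 => j _; rewrite -expr2 sqr_ge0.
Qed.

Lemma enorm_le_coord (R : realType) n (u : 'cV[R]_n) (r : R) :
  (forall i, `|u i 0| <= r) -> enorm u <= n%:R * `|r|.
Proof.
move=> ur; rewrite enorm_leP ?mulr_ge0//.
apply: (@le_trans _ _ (\sum_(i < n) r ^+ 2)).
  apply: ler_sum => i _; rewrite -expr2 -real_normK ?num_real//.
  rewrite ler_pXn2r ?nnegrE// ?(ur i)//; exact: le_trans (ur i).
rewrite sumr_const card_ord exprMn -normrX ger0_norm ?sqr_ge0// -[leLHS]mulr_natl.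
rewrite ler_wpM2r ?sqr_ge0//; case: n {u ur} => [|n]; first by rewrite expr0n.
by rewrite expr2 ler_peMl// ler1n.
Qed.

Lemma dotv_subZ (R : realType) n (t : R) (u v : 'cV[R]_n) :
  dotv (u - t *: v) (u - t *: v) = dotv u u - 2 * t * dotv u v + t ^+ 2 * dotv v v.
Proof. by rewrite !dotvE (dotvC v u); ring. Qed.

Lemma projection_variational (R : realType) n (X : set 'cV[R]_n) (z p : 'cV[R]_n) :
  convex_set_cv X -> X p -> (forall v, X v -> enorm (z - p) <= enorm (z - v)) ->
  forall v, X v -> dotv (z - p) (v - p) <= 0.
Proof.
move=> cX Xp zp v Xv; rewrite leNgt; apply/negP => a0.
set a := dotv (z - p) (v - p) in a0 *.
set b := dotv (v - p) (v - p).
have b0 : 0 <= b by exact: dotv_ge0.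
(* [a + b] rather than [b], so that [t <= 1] and [b = 0] is allowed *)
set t := a / (a + b).
have ab : 0 < a + b by rewrite ltr_wpDr.
have tab : t * (a + b) = a by rewrite /t mulfVK// gt_eqF.
have t0 : 0 < t by rewrite divr_gt0.
have t1 : t <= 1 by rewrite ler_pdivrMr// mul1r lerDl.
have Xq : X (t *: v + (1 - t) *: p) by apply: cX => //; rewrite ltW.
have := zp _ Xq.
have -> : z - (t *: v + (1 - t) *: p) = (z - p) - t *: (v - p).
  by apply/matrixP => i j; rewrite !mxE; ring.
rewrite enorm_le dotv_subZ -/a -/b => h.
(* Since [t * b = a - t * a], this inequality reads [a * (1 + t) <= 0], which is absurd. *)
have {h} : 2 * a <= t * b.
  have : 0 <= t * (t * b - 2 * a) by nra.
  by rewrite pmulr_rge0// subr_ge0.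
nra.
Qed.

(** The two variational inequalities add up to [|p1 - p2| ^ 2 <= dotv (z1 - z2) (p1 - p2)].
    Expanding the square of [(z1 - z2) - (p1 - p2)] then replaces Cauchy-Schwarz and keeps the
    arithmetic linear. *)
Lemma projection_nonexpansive (R : realType) n (X : set 'cV[R]_n)
  (z1 z2 p1 p2 : 'cV[R]_n) : convex_set_cv X ->
  X p1 -> (forall v, X v -> enorm (z1 - p1) <= enorm (z1 - v)) ->
  X p2 -> (forall v, X v -> enorm (z2 - p2) <= enorm (z2 - v)) ->
  enorm (p1 - p2) <= enorm (z1 - z2).
Proof.
move=> cX X1 h1 X2 h2.
have := projection_variational cX X1 h1 X2.
have := projection_variational cX X2 h2 X1.
rewrite enorm_le.
have : 0 <= dotv ((z1 - z2) - (p1 - p2)) ((z1 - z2) - (p1 - p2)) by exact: dotv_ge0.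
rewrite !dotvE (dotvC p2 p1) (dotvC z2 z1).
rewrite !(dotvC _ z1) !(dotvC _ z2) (dotvC z2 z1); lra.
Qed.

Lemma projection_unique (R : realType) n (X : set 'cV[R]_n) (z p1 p2 : 'cV[R]_n) :
  convex_set_cv X ->
  X p1 -> (forall v, X v -> enorm (z - p1) <= enorm (z - v)) ->
  X p2 -> (forall v, X v -> enorm (z - p2) <= enorm (z - v)) ->
  p1 = p2.
Proof.
move=> cX X1 h1 X2 h2; apply/subr0_eq/dotv_eq0/le_anti; rewrite dotv_ge0 andbT.
have := projection_nonexpansive cX X1 h1 X2 h2.
by rewrite enorm_le subrr -{2}(scale0r (0 : 'cV[R]_n)) dotvZr mul0r.
Qed.

Lemma enorm_lipschitz_continuous (R : realType) n (f : 'cV[R]_n -> R) (C : R) :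
  (forall u v, `|f u - f v| <= C * enorm (u - v)) -> continuous f.
Proof.
move=> fC u s /= /(nbhs_ballP (f u)) [e /= e0 es].
(* Balls of matrices are coordinatewise, whence the factor [n]; the [+ 1] keeps the radius
   meaningful when [C] or [n] is zero. *)
have K0 : 0 < `|C| * n%:R + 1 by rewrite ltr_wpDl ?mulr_ge0.
have r0 : 0 < e / (`|C| * n%:R + 1) by rewrite divr_gt0.
apply/nbhs_ballP; exists (e / (`|C| * n%:R + 1)) => //= v [_ uv]; apply: es => /=.
rewrite /ball/=; have h : enorm (u - v) <= n%:R * `|e / (`|C| * n%:R + 1)|.
  by apply: enorm_le_coord => i; rewrite !mxE; apply/ltW; exact: uv.
rewrite (le_lt_trans (fC _ _))// (@le_lt_trans _ _ (`|C| * enorm (u - v)))//.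
  by rewrite ler_wpM2r ?enorm_ge0 ?ler_norm.
rewrite (le_lt_trans (ler_wpM2l _ h))// (ger0_norm (ltW r0)) !mulrA.
rewrite ltr_pdivrMr// [ltRHS]mulrC ltr_pM2r//; lra.
Qed.

Lemma projection_exists (R : realType) n (X : set 'cV[R]_n) :
  X !=set0 -> compact X ->
  exists p : 'cV[R]_n -> 'cV[R]_n,
    forall z, X (p z) /\ forall v, X v -> enorm (z - p z) <= enorm (z - v).
Proof.
move=> X0 cX.
suff h z : exists q, X q /\ forall v, X v -> enorm (z - q) <= enorm (z - v).
  by have [p hp] := choice h; exists p.
have ctn : continuous (fun v : 'cV[R]_n => enorm (z - v)).
  apply: (@enorm_lipschitz_continuous _ _ _ 1) => u v; rewrite mul1r.
  have h1 : z - v = (z - u) + (u - v) by rewrite addrA subrK.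
  have h2 : z - u = (z - v) + - (u - v) by rewrite opprB addrA subrK.
  have := enorm_triangle (z - u) (u - v); have := enorm_triangle (z - v) (- (u - v)).
  by rewrite -h1 -h2 enormN ler_norml => *; apply/andP; split; lra.
have [q Xq qmin] := compact_EVT_min X0 cX (continuous_subspaceT ctn).
by exists q; split => [|v Xv]; [rewrite inE in Xq | apply: qmin; rewrite inE].
Qed.

(** * Largest eigenvalue *)

(* The maximum of the Rayleigh quotient on the unit sphere is an eigenvalue. *)
Lemma lambda_max_dotv (R : realType) n (M : 'M[R]_n) (lam : R) :
  M^T = M -> is_lambda_max M lam ->
  forall u : 'cV[R]_n, dotv u (M *m u) <= lam * dotv u u.
Proof.
move=> MT [_ lammax] u0.
have [->|u0N] := eqVneq u0 0.
  by rewrite -(scale0r (0 : 'cV[R]_n)) !dotvE !mul0r mulr0.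
have normalize (u : 'cV[R]_n) : u != 0 ->
    0 < dotv u u /\ dotv ((enorm u)^-1 *: u) ((enorm u)^-1 *: u) = 1.
  move=> uN; have uu : 0 < dotv u u.
    by rewrite lt_neqAle dotv_ge0 andbT eq_sym; apply: contra_neq uN => /dotv_eq0.
  split=> //; rewrite !dotvE -enorm_sqr; field.
  by rewrite gt_eqF// sqrtr_gt0.
(* Rows rather than columns: both [eigenvalueP] and [bounded_closed_compact] speak of row
   vectors. *)
pose S := [set v : 'rV[R]_n | dotv v^T v^T = 1].
pose f (v : 'rV[R]_n) := dotv v^T (M *m v^T).
(* A general [N] serves twice: [N = M] for the function to maximize, [N = 1] for the closedness of
   the sphere. *)
have ctq (N : 'M[R]_n) : continuous (fun v : 'rV[R]_n => dotv v^T (N *m v^T)).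
  move=> v; have -> : (fun v : 'rV[R]_n => dotv v^T (N *m v^T)) =
      fun v => \sum_i \sum_j (N i j * (v 0 i * v 0 j)).
    apply/funext => w; apply: eq_bigr => i _; rewrite !mxE mulr_sumr.
    by apply: eq_bigr => j _; rewrite !mxE mulrCA.
  have FF : Filter (nbhs v) := nbhs_filter v.
  apply: (@cvg_big _ _ _ _ _ add_continuous _ (nbhs v)) => i _ /=.
  apply: (@cvg_big _ _ _ _ _ add_continuous _ (nbhs v)) => j _.
  apply: (@cvgM _ _ (nbhs v)); first exact: cvg_cst.
  by apply: (@cvgM _ _ (nbhs v)); exact: coord_continuous.
have S0 : S !=set0.
  by exists ((enorm u0)^-1 *: u0)^T; rewrite /S/= trmxK; exact: (normalize _ u0N).2.
have cS : compact S.
  apply: bounded_closed_compact.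
    exists 1; split; first exact: num_real.
    move=> r r1 v Sv /=; rewrite [leLHS]mx_normrE.
    apply/bigmax_leP; split => [|[i j] _ /=]; first by rewrite (le_trans _ (ltW r1)).
    have := coord_le_enorm v^T j; rewrite mxE ord1 /enorm Sv sqrtr1 => /le_trans; apply.
    exact: ltW.
  have -> : S = (fun v : 'rV[R]_n => dotv v^T (1%:M *m v^T)) @^-1` [set 1].
    by apply/seteqP; split => v /=; rewrite mul1mx.
  by apply: closed_comp => [v _|]; [exact: ctq | exact: closed_eq].
have [v0 Sv0 v0max] := compact_EVT_max S0 cS (continuous_subspaceT (ctq M)).
rewrite inE in Sv0; set m := dotv v0^T (M *m v0^T) in v0max.
have mub (u : 'cV[R]_n) : dotv u (M *m u) <= m * dotv u u.
  have [->|uN] := eqVneq u 0.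
    by rewrite -(scale0r (0 : 'cV[R]_n)) !dotvE !mul0r mulr0.
  have [uu nu] := normalize _ uN.
  have := v0max ((enorm u)^-1 *: u)^T; rewrite inE /S/= trmxK => /(_ nu).
  rewrite -scalemxAr !dotvE mulrA -expr2 exprVn enorm_sqr mulrC.
  by rewrite ler_pdivrMr.
apply: (le_trans (mub u0)); rewrite ler_wpM2r ?dotv_ge0//; apply: lammax.
(* The residual [h] is orthogonal to [v], and [- h] is an ascent direction: if [h] were nonzero, a
   small move to [v - t *: h] would exceed the maximal quotient [m]. The choice of [t] is the one
   made for projections. *)
pose v := v0^T; pose h := m *: v - M *m v.
have hv : dotv h v = 0.
  by rewrite /h dotvDl dotvNl dotvZl (dotvC (M *m v)) -/m Sv0 mulr1 subrr.
have Msym (a b : 'cV[R]_n) : dotv a (M *m b) = dotv (M *m a) b.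
  by rewrite dotv_mulmxr MT.
have h0 : h = 0.
  apply: dotv_eq0; apply/eqP; rewrite eq_le dotv_ge0 andbT leNgt; apply/negP => a0.
  set a := dotv h h in a0.
  set b := m * a - dotv h (M *m h).
  have b0 : 0 <= b by rewrite subr_ge0 mub.
  set t := a / (a + b).
  have ab : 0 < a + b by rewrite ltr_wpDr.
  have tab : t * (a + b) = a by rewrite /t mulfVK// gt_eqF.
  have t0 : 0 < t by rewrite divr_gt0.
  have e1 : dotv v (M *m h) = - a.
    rewrite Msym; have -> : M *m v = m *: v - h by rewrite opprB addrC subrK.
    by rewrite dotvDl dotvNl dotvZl (dotvC v) hv mulr0 sub0r.
  have e2 : dotv h (M *m v) = - a by rewrite Msym dotvC.
  have := mub (v - t *: h).
  rewrite dotv_subZ mulmxBr -scalemxAr (dotvC v h) hv Sv0.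
  rewrite dotvDl !dotvDr !dotvNl !dotvNr !dotvZl !dotvZr e1 e2 -/m -/a => h1.
  have {h1} : 2 * a <= t * b.
    have : 0 <= t * (t * b - 2 * a) by rewrite /b; nra.
    by rewrite pmulr_rge0// subr_ge0.
  nra.
apply/eigenvalueP; exists v0.
  apply: trmx_inj; rewrite trmx_mul MT -/v linearZ/= -/v.
  by apply/eqP; rewrite eq_sym -subr_eq0 -/h h0.
apply/eqP => v00; move: Sv0; rewrite v00 /S/= trmx0 -(scale0r (0 : 'cV[R]_n)) dotvZl mul0r.
by move/eqP; rewrite eq_sym oner_eq0.
Qed.

Lemma lambda_max_ge0 (R : realType) m n (F : 'M[R]_(m, n)) (lam : R) :
  is_lambda_max (F^T *m F) lam -> 0 <= lam.
Proof.
move=> [/eigenvalueP[v ve v0] _].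
have v0' : 0 < dotv v^T v^T.
  rewrite lt_neqAle dotv_ge0 andbT eq_sym; apply: contra_neq v0 => /dotv_eq0.
  by move/(congr1 trmx); rewrite trmxK trmx0.
have : 0 <= dotv (F *m v^T) (F *m v^T) by exact: dotv_ge0.
rewrite dotv_mulmxr mulmxA.
have -> : F^T *m F *m v^T = lam *: v^T.
  by rewrite -linearZ/= -ve !trmx_mul trmxK.
by rewrite dotvZl pmulr_lge0.
Qed.

(** The bound passes from [F^T F] to [F F^T] without comparing spectra: with [w = F^T u], one has
    [|w| ^ 4 = (dotv u (F w)) ^ 2 <= |u| ^ 2 * |F w| ^ 2 <= lam * |u| ^ 2 * |w| ^ 2], and [|w| ^ 2]
    cancels. *)
Lemma lambda_max_trmx (R : realType) m n (F : 'M[R]_(m, n)) (lam : R) :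
  is_lambda_max (F^T *m F) lam ->
  forall u : 'cV[R]_m, dotv (F^T *m u) (F^T *m u) <= lam * dotv u u.
Proof.
move=> hlam u; have lam0 := lambda_max_ge0 hlam.
set w := F^T *m u.
have h1 : dotv (F *m w) (F *m w) <= lam * dotv w w.
  rewrite dotv_mulmxr dotvC mulmxA; apply: lambda_max_dotv hlam _.
  by rewrite trmx_mul trmxK.
have h2 : dotv w w = dotv u (F *m w) by rewrite dotv_mulmxr.
have [->|w0] := eqVneq (dotv w w) 0; first by rewrite mulr_ge0 ?dotv_ge0.
have {w0} w0 : 0 < dotv w w by rewrite lt_neqAle eq_sym w0 dotv_ge0.
rewrite -(ler_pM2r w0) -expr2 {1}h2.
have := ler_pM (normr_ge0 _) (normr_ge0 _) (dotv_norm_le u (F *m w)) (dotv_norm_le u (F *m w)).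
rewrite -!expr2 real_normK ?num_real// exprMn !enorm_sqr => /le_trans; apply.
by rewrite mulrAC [leRHS]mulrC ler_wpM2l ?dotv_ge0.
Qed.

(** * One step of the algorithm *)

(* Bisecting the segment [[x, y]] improves a constant [C] into [C / 2 + L / 4],
   whose fixed point is [L / 2]. *)
Lemma descent_lemma (R : realType) n (X : set 'cV[R]_n) (f : 'cV[R]_n -> R)
  (g : 'cV[R]_n -> 'cV[R]_n) (L : R) :
  convex_set_cv X -> grad_lipschitz_on X g L -> 0 <= L ->
  (forall x y, X x -> X y -> dotv (y - x) (g x) <= f y - f x) ->
  forall x y, X x -> X y ->
    f y <= f x + dotv (g x) (y - x) + L / 2 * dotv (y - x) (y - x).
Proof.
move=> cX gL L0 fg.
have lip (x y : 'cV[R]_n) : X x -> X y -> dotv (g y - g x) (y - x) <= L * dotv (y - x) (y - x).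
  move=> Xx Xy; rewrite (le_trans (CauchySchwarz_dotv _ _))// -enorm_sqr expr2 mulrA.
  by rewrite ler_wpM2r ?enorm_ge0 ?gL.
have step k (x y : 'cV[R]_n) : X x -> X y ->
    f y <= f x + dotv (g x) (y - x)
           + (L / 2 + L / 2 * 2^-1 ^+ k) * dotv (y - x) (y - x).
  elim: k x y => [|k IH] x y Xx Xy.
    have := fg _ _ Xy Xx; have := lip _ _ Xx Xy.
    by rewrite expr0 -(opprB y x) !dotvE (dotvC _ (g y)) (dotvC _ (g y)); lra.
  pose m := 2^-1 *: x + (1 - 2^-1) *: y.
  have Xm : X m by apply: cX => //; lra.
  have := IH _ _ Xx Xm; have := IH _ _ Xm Xy; have := lip _ _ Xx Xm.
  have -> : y - m = 2^-1 *: (y - x) by apply/matrixP => i j; rewrite !mxE; field.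
  have -> : m - x = 2^-1 *: (y - x) by apply/matrixP => i j; rewrite !mxE; field.
  rewrite exprS [dotv (g m - g x) _]dotvDl dotvNl !dotvZl !dotvZr.
  set D := dotv (y - x) (y - x); set p := 2^-1 ^+ k; lra.
move=> x y Xx Xy; set D := dotv (y - x) (y - x).
rewrite -subr_le0; set c := f y - _; rewrite leNgt; apply/negP => c0.
have cb k : c <= L / 2 * 2^-1 ^+ k * D.
  by have := step k _ _ Xx Xy; rewrite /c -/D; lra.
have : (fun k => L / 2 * D * 2^-1 ^+ k) @ \oo --> L / 2 * D * 0.
  apply: cvgM; first exact: cvg_cst.
  by apply: cvg_expr; rewrite ger0_norm ?invr_ge0 ?invf_lt1 ?ltr1n.
rewrite mulr0 => /cvgrPdist_lt/(_ _ c0)[N _ /(_ N (leqnn N))].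
rewrite /= sub0r normrN => /ltr_normlW; apply/negP.
by rewrite -leNgt (le_trans (cb N))// mulrAC.
Qed.

(** Adding strong convexity at [(x, y)] and at [(y, x)] bounds [mu * |x - y| ^ 2] by
    [dotv (g x - g y) (x - y)]. It supplies [0 <= L], which is not assumed, as soon as [X] has two
    points. *)
Lemma lipschitz_ge_strong_convexity (R : realType) n (X : set 'cV[R]_n)
  (f : 'cV[R]_n -> R) (g : 'cV[R]_n -> 'cV[R]_n) (L mu : R) (x y : 'cV[R]_n) :
  grad_lipschitz_on X g L -> strongly_convex_on X f g mu ->
  X x -> X y -> x != y -> mu <= L.
Proof.
move=> gL sc Xx Xy xy.
have d0 : 0 < dotv (x - y) (x - y).
  rewrite lt_neqAle dotv_ge0 andbT eq_sym; apply: contra_neq xy => /dotv_eq0.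
  exact: subr0_eq.
rewrite -(ler_pM2r d0).
have h1 := sc _ _ Xx Xy; have h2 := sc _ _ Xy Xx.
have h3 : dotv (g x - g y) (x - y) <= L * dotv (x - y) (x - y).
  rewrite (le_trans (CauchySchwarz_dotv _ _))// -enorm_sqr expr2 mulrA.
  by rewrite ler_wpM2r ?enorm_ge0 ?gL.
move: h1 h2 h3; rewrite -(opprB x y) enormN !enorm_sqr [dotv (- (x - y)) (g x)]dotvNl.
rewrite !(dotvC (x - y) (g _)) (dotvDl (g x)) (dotvNl (g y)); lra.
Qed.

Lemma young_dotv (R : realType) n (u v a : 'cV[R]_n) (c : R) : 0 < c ->
  dotv u a - dotv v a <= c / 4 * dotv a a + 2 * (dotv u u + dotv v v) / c.
Proof.
move=> c0; have h2 := dotv_ge0 (u - v - (c / 2) *: a).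
have h3 := dotv_ge0 (u + v).
rewrite -lerBlDl ler_pdivlMr//.
move: h2 h3; rewrite dotv_subZ !dotvE (dotvC v u); nra.
Qed.

(** With [a = x' - x] and [e = x - xs], the projection inequality yields [kap / 2 * (|e| ^ 2 - |a +
    e| ^ 2 - |a| ^ 2)]. As [kap / 2 = c / 4 + L / 2], the descent lemma uses up [L / 2 * |a| ^ 2],
    and the remaining [c / 4 * |a| ^ 2] is exactly what Young's inequality costs. *)
Lemma primal_dual_step (R : realType) d l (X : set 'cV[R]_d) (Y : set 'cV[R]_l)
  (F : 'M[R]_(l, d)) (lam : R) (lf : 'cV[R]_d -> R) (gl : 'cV[R]_d -> 'cV[R]_d)
  (L mu s c Dy : R) (x x' xs zeta : 'cV[R]_d) (y y' ys : 'cV[R]_l) :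
  convex_set_cv X -> convex_set_cv Y -> is_lambda_max (F^T *m F) lam ->
  grad_lipschitz_on X gl L -> 0 <= L -> 0 < mu -> strongly_convex_on X lf gl mu ->
  0 < s -> 0 < c -> X x -> X xs -> Y ys -> enorm (ys - y') <= Dy ->
  Y y' -> (forall v, Y v -> enorm (y + s *: (F *m x) - y') <= enorm (y + s *: (F *m x) - v)) ->
  X x' ->
  (let z := x - (c / 2 + L)^-1 *: (gl x + zeta + F^T *m y') in
   forall v, X v -> enorm (z - x') <= enorm (z - v)) ->
  saddleP lf F ys x' - saddleP lf F y' xs <=
    ((c / 2 + L) / 2 - mu / 2) * dotv (x - xs) (x - xs)
    - (c / 2 + L) / 2 * dotv (x' - xs) (x' - xs)
    + (2 * s)^-1 * (dotv (y - ys) (y - ys) - dotv (y' - ys) (y' - ys))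
    + dotv zeta (xs - x) + 2 * (lam * Dy ^+ 2 + dotv zeta zeta) / c.
Proof.
move=> cX cY hlam gL L0 mu0 sc s0 c0 Xx Xxs Yys yD Yy' hy Xx' hx.
have fg u v : X u -> X v -> dotv (v - u) (gl u) <= lf v - lf u.
  move=> Xu Xv; have := sc _ _ Xu Xv; rewrite enorm_sqr.
  have := dotv_ge0 (v - u); nra.
have hd := descent_lemma cX gL L0 fg Xx Xx'.
have hs := sc _ _ Xx Xxs.
have hyv := projection_variational cY Yy' hy Yys.
have hxv := projection_variational cX Xx' hx Xxs.
have hl := lambda_max_trmx hlam (ys - y').
have D0 : dotv (ys - y') (ys - y') <= Dy ^+ 2.
  by rewrite -enorm_leP// (le_trans (enorm_ge0 _) yD).
set kap := c / 2 + L in hx hxv *.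
have kap0 : 0 < kap by rewrite /kap; lra.
pose a := x' - x; pose e := x - xs; pose eta := ys - y'; pose h := y' - y.
pose w := gl x + zeta + F^T *m y'.
have xe : x' - xs = a + e by apply/matrixP => i j; rewrite !mxE; ring.
have ye : y - ys = - (eta + h) by apply/matrixP => i j; rewrite !mxE; ring.
have ye' : y' - ys = - eta by rewrite opprB.
have {}hxv : dotv w (a + e) <= - kap * (dotv a a + dotv a e).
  move: hxv; rewrite -(ler_pM2l kap0) mulr0.
  have -> : x - kap^-1 *: w - x' = - a - kap^-1 *: w.
    by apply/matrixP => i j; rewrite !mxE; ring.
  have -> : xs - x' = - (a + e) by rewrite -xe opprB.
  rewrite dotvNr dotvDl !dotvNl dotvZl dotvDr.
  by rewrite -opprD opprK mulrDr mulrA divff ?gt_eqF// mul1r; lra.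
(* The extra [dotv h h] completes the right-hand side into a difference of squared distances to
   [ys], which telescopes. *)
have {}hyv : dotv (F *m x) eta <= (2 * s)^-1 * (2 * dotv eta h + dotv h h).
  move: hyv.
  have -> : y + s *: (F *m x) - y' = s *: (F *m x) - h.
    by apply/matrixP => i j; rewrite !mxE; ring.
  rewrite dotvDl dotvNl dotvZl -/eta (dotvC h) subr_le0 => hh.
  rewrite mulrC ler_pdivlMr ?mulr_gt0//; have := dotv_ge0 h; nra.
have young : dotv (F^T *m eta) a - dotv zeta a
    <= c / 4 * dotv a a + 2 * (lam * Dy ^+ 2 + dotv zeta zeta) / c.
  have lam0 := lambda_max_ge0 hlam.
  have h1 : dotv (F^T *m eta) (F^T *m eta) <= lam * Dy ^+ 2.
    by rewrite (le_trans hl)// ler_wpM2l.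
  apply: (le_trans (young_dotv _ _ _ c0)); rewrite lerD2l ler_wpM2r ?invr_ge0 ?(ltW c0)//.
  by rewrite ler_wpM2l// lerD2r.
(* The dual step sees [x], not [x']: hence the pairing with [F *m x], which [hyv] controls, plus the
   error [dotv (F^T *m eta) a], which goes into Young's inequality. *)
have gap : saddleP lf F ys x' - saddleP lf F y' xs =
    lf x' - lf xs + dotv (F^T *m y') (a + e) + dotv (F *m x) eta + dotv (F^T *m eta) a.
  rewrite /saddleP -xe -!dotv_mulmxr (dotvC (F *m x)) /a /eta !mulmxBr !dotvE; ring.
have sq m (u v : 'cV[R]_m) : dotv (u + v) (u + v) = dotv u u + 2 * dotv u v + dotv v v.
  by rewrite !dotvE (dotvC v u); ring.
have fy : dotv (y - ys) (y - ys) - dotv (y' - ys) (y' - ys) = 2 * dotv eta h + dotv h h.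
  by rewrite ye ye' !dotvNl !dotvNr !opprK sq; ring.
have {}hd : lf x' <= lf x + dotv (gl x) a + L / 2 * dotv a a by [].
have {}hs : mu / 2 * dotv e e <= lf xs - lf x + dotv (gl x) e.
  by move: hs; rewrite -(opprB x xs) enormN enorm_sqr dotvNl opprK (dotvC _ (gl x)).
have {}hxv : dotv (gl x) a + dotv (gl x) e + dotv zeta a + dotv zeta e
    + dotv (F^T *m y') (a + e) <= - kap * (dotv a a + dotv a e).
  by move: hxv; rewrite /w !(dotvDl _ _ (a + e)) !(dotvDr a e); lra.
have ze : dotv zeta (xs - x) = - dotv zeta e by rewrite -dotvNr opprB.
rewrite gap xe fy (sq _ a e) ze -/e; move: hxv; rewrite /kap; lra.
Qed.

(** Completing the square: [- 2 * s] times the objective equals [|y + s *: (F *m x) - v| ^ 2] up to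
    terms free of [v]. *)
Lemma dual_step_projection (R : realType) d l (Y : set 'cV[R]_l) (F : 'M[R]_(l, d))
  (lf : 'cV[R]_d -> R) (s : R) (x : 'cV[R]_d) (y y' : 'cV[R]_l) : 0 < s ->
  (forall v, Y v ->
     saddleP lf F v x - (2 * s)^-1 * enorm (v - y) ^+ 2
     <= saddleP lf F y' x - (2 * s)^-1 * enorm (y' - y) ^+ 2) ->
  forall v, Y v ->
    enorm (y + s *: (F *m x) - y') <= enorm (y + s *: (F *m x) - v).
Proof.
move=> s0 h v /h; rewrite /saddleP !enorm_sqr enorm_le => {}h.
have e (u : 'cV[R]_l) : dotv (y + s *: (F *m x) - u) (y + s *: (F *m x) - u) =
    dotv (u - y) (u - y) - 2 * s * dotv u (F *m x)
    + 2 * s * dotv y (F *m x) + s ^+ 2 * dotv (F *m x) (F *m x).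
  move: (F *m x) => b.
  by rewrite !dotvE (dotvC b y) (dotvC b u) (dotvC u y); ring.
rewrite !e !lerD2r.
have s20 : 0 < 2 * s by rewrite mulr_gt0.
have := ler_wpM2l (ltW s20) h.
rewrite !mulrBr !mulrDr !mulrA divff ?gt_eqF// !mul1r; lra.
Qed.

(** * Weighted averages and the deterministic bound on the gap *)

(** Dividing by the partial sum [A] lets the induction on [m] keep the same weights, and [0 < a 0]
    makes every partial sum positive. *)
Lemma convex_fun_jensen (R : realType) n (X : set 'cV[R]_n) (f : 'cV[R]_n -> R)
  (m : nat) (a : nat -> R) (u : nat -> 'cV[R]_n) :
  convex_set_cv X -> convex_fun_on X f ->
  (forall k, 0 <= a k) -> 0 < a 0%N -> (forall k, X (u k)) ->
  let A := \sum_(k < m.+1) a k in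
  X (A^-1 *: \sum_(k < m.+1) a k *: u k) /\
  f (A^-1 *: \sum_(k < m.+1) a k *: u k) <= A^-1 * \sum_(k < m.+1) a k * f (u k).
Proof.
move=> cX cf a0 a00 Xu /=; elim: m => [|m [IH1 IH2]].
  by rewrite !big_ord1 scalerA !mulrA mulVf ?gt_eqF// scale1r mul1r.
pose A := \sum_(k < m.+1) a k; pose S := \sum_(k < m.+1) a k *: u k.
pose T := \sum_(k < m.+1) a k * f (u k).
rewrite -/A -/S -/T in IH1 IH2.
have -> : \sum_(k < m.+2) a k = A + a m.+1 by rewrite big_ord_recr.
have -> : \sum_(k < m.+2) a k *: u k = S + a m.+1 *: u m.+1 by rewrite big_ord_recr.
have -> : \sum_(k < m.+2) a k * f (u k) = T + a m.+1 * f (u m.+1) by rewrite big_ord_recr.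
have A0 : 0 < A by rewrite /A big_ord_recl ltr_wpDr// sumr_ge0.
have B0 : 0 < A + a m.+1 by rewrite ltr_wpDr.
pose t := A / (A + a m.+1).
have t01 : 0 <= t <= 1.
  by rewrite divr_ge0 ?(ltW A0) ?(ltW B0)//= ler_pdivrMr// mul1r lerDl.
have AN : A != 0 by rewrite gt_eqF.
have BN : A + a m.+1 != 0 by rewrite gt_eqF.
have -> : (A + a m.+1)^-1 *: (S + a m.+1 *: u m.+1)
    = t *: (A^-1 *: S) + (1 - t) *: u m.+1.
  by apply/matrixP => i j; rewrite !mxE /t; field; rewrite AN BN.
split; first exact: cX.
rewrite (le_trans (cf _ _ IH1 (Xu m.+1) t t01))//.
have -> : (A + a m.+1)^-1 * (T + a m.+1 * f (u m.+1))
    = t * (A^-1 * T) + (1 - t) * f (u m.+1).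
  by rewrite /t; field; rewrite AN BN.
by rewrite lerD2r ler_wpM2l//; case/andP: t01.
Qed.

Lemma weighted_telescope (R : realType) (gap d e Z N : nat -> R)
  (L mu s D1 D2 lamD : R) : 0 <= L -> 0 < mu -> 0 < s -> 0 <= lamD ->
  (forall k, 0 <= d k <= D1) -> (forall k, 0 <= e k <= D2) -> (forall k, 0 <= N k) ->
  (forall k, gap k <=
     ((mu * (k%:R + 2) / 2 + L) / 2 - mu / 2) * d k
     - (mu * (k%:R + 2) / 2 + L) / 2 * d k.+1
     + (2 * s)^-1 * (e k - e k.+1) + Z k + 2 * (lamD + N k) / (mu * (k%:R + 2))) ->
  forall n, \sum_(k < n) (k%:R + 1) * gap k <=
    n%:R * (L / 2 * D1 + (2 * s)^-1 * D2 + 2 * lamD / mu)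
    + \sum_(k < n) (k%:R + 1) * Z k + 2 / mu * \sum_(k < n) N k.
Proof.
move=> L0 mu0 s0 lamD0 hd he hN hgap n.
have s20 : 0 < (2 * s)^-1 by rewrite invr_gt0 mulr_gt0.
(* The induction needs the potentials on the left. At step [n] the coefficient of [d n] is [(n + 1)
   * ((mu * (n + 2) / 2 + L) / 2 - mu / 2) = n * (mu * (n + 1) + 2 * L) / 4 + L / 2]: the old
   potential plus an excess [L / 2], bounded through [D1]. Likewise [e n] leaves an excess
   [(2 * s)^-1], bounded through [D2]. *)
suff : \sum_(k < n) (k%:R + 1) * gap k
    + n%:R * (mu * (n%:R + 1) + 2 * L) / 4 * d n + n%:R * (2 * s)^-1 * e n <=
    n%:R * (L / 2 * D1 + (2 * s)^-1 * D2 + 2 * lamD / mu)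
    + \sum_(k < n) (k%:R + 1) * Z k + 2 / mu * \sum_(k < n) N k.
  have /andP[d0 _] := hd n; have /andP[e0 _] := he n.
  apply: le_trans; rewrite -addrA lerDl addr_ge0// mulr_ge0// ?mulr_ge0//.
    by rewrite addr_ge0 ?mulr_ge0 ?addr_ge0 ?(ltW mu0).
  exact: ltW.
elim: n => [|n IH]; first by rewrite !big_ord0 !mul0r !mulr0 !addr0.
rewrite !big_ord_recr /=.
set G := \sum_(k < n) _ in IH *; set SZ := \sum_(k < n) (_ * Z _) in IH *.
set SN := \sum_(k < n) N _ in IH *.
have /andP[d0 d1] := hd n; have /andP[e0 e1] := he n.
have n0 : 0 <= n%:R :> R by [].
have n1 : 0 <= n%:R + 1 :> R by rewrite addr_ge0.
have gn := ler_wpM2l n1 (hgap n).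
(* The weight [n + 1] compensates the decay in [n + 2], so every step contributes at most a
   constant. *)
have frac : (n%:R + 1) * (2 * (lamD + N n) / (mu * (n%:R + 2))) <=
    2 * lamD / mu + 2 / mu * N n.
  have -> : (n%:R + 1) * (2 * (lamD + N n) / (mu * (n%:R + 2))) =
      (n%:R + 1) / (n%:R + 2) * (2 * lamD / mu + 2 / mu * N n).
    by field; rewrite gt_eqF//= gt_eqF//; lra.
  rewrite ler_piMl//.
    by rewrite addr_ge0// ?mulr_ge0// ?invr_ge0 ?(ltW mu0)// hN.
  by rewrite ler_pdivrMr; lra.
move: gn; rewrite mulrDr mulrDr => gn.
rewrite -(natr1 n).
have Ld : L / 2 * d n <= L / 2 * D1 by rewrite ler_wpM2l// divr_ge0.
have se : (2 * s)^-1 * e n <= (2 * s)^-1 * D2 by rewrite ler_wpM2l// ltW.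
have nd : n%:R + 1 + 1 = n%:R + 2 :> R by ring.
set q := (n%:R + 1) * (2 * _ / _) in gn frac.
set i2 := (2 * s)^-1 in gn IH se *.
set u1 := 2 * lamD / mu in frac IH *.
set u2 := 2 / mu in frac IH *.
move: gn IH frac Ld se; clear; move: n%:R (gap n) (d n) (d n.+1) (e n) (e n.+1) (Z n) (N n).
move=> m g dn dn' en en' z nn; lra.
Qed.

Lemma sum_succ (R : realType) n : \sum_(k < n) (k%:R + 1 : R) = n%:R * (n%:R + 1) / 2.
Proof.
elim: n => [|n IH]; first by rewrite big_ord0 mul0r mul0r.
by rewrite big_ord_recr/= IH -natr1; field.
Qed.

Lemma sum_succ_sqr (R : realType) n :
  \sum_(k < n) (k%:R + 1 : R) ^+ 2 = n%:R * (n%:R + 1) * (2 * n%:R + 1) / 6.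
Proof.
elim: n => [|n IH]; first by rewrite big_ord0 !mul0r.
by rewrite big_ord_recr/= IH -natr1; field.
Qed.

(** Deterministic: it is meant for one trajectory at a time, with [zeta] the realized noise. Since
    [saddleP] is convex in [x] and affine in [y], the gap of the averages is at most the average of
    the gaps. *)
Lemma primal_dual_gap (R : realType) d l (X : set 'cV[R]_d) (Y : set 'cV[R]_l)
  (Dx Dy : R) (F : 'M[R]_(l, d)) (lam : R) (lf : 'cV[R]_d -> R)
  (gl : 'cV[R]_d -> 'cV[R]_d) (L mu s : R) (x zeta : nat -> 'cV[R]_d)
  (y : nat -> 'cV[R]_l) (ys : 'cV[R]_l) (xs : 'cV[R]_d) (t : nat) :
  convex_set_cv X -> (forall u v, X u -> X v -> enorm (u - v) <= Dx) ->
  convex_set_cv Y -> (forall u v, Y u -> Y v -> enorm (u - v) <= Dy) ->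
  is_lambda_max (F^T *m F) lam ->
  convex_fun_on X lf -> grad_lipschitz_on X gl L -> 0 <= L ->
  0 < mu -> strongly_convex_on X lf gl mu -> 0 < s ->
  X xs -> Y ys -> (forall k, X (x k)) -> (forall k, Y (y k)) ->
  (forall k v, Y v -> enorm (y k + s *: (F *m x k) - y k.+1)
                      <= enorm (y k + s *: (F *m x k) - v)) ->
  (forall k, let beta := 2 / (mu * (k%:R + 2) + 2 * L) in
     let z := x k - beta *: (gl (x k) + zeta k + F^T *m y k.+1) in
     forall v, X v -> enorm (z - x k.+1) <= enorm (z - v)) ->
  let alpha (k : nat) : R := 2 * (k%:R + 1) / ((t%:R + 1) * (t%:R + 2)) in
  let xbar := \sum_(k < t.+1) alpha k *: x k.+1 in
  let ybar := \sum_(k < t.+1) alpha k *: y k.+1 in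
  X xbar /\
  saddleP lf F ys xbar - saddleP lf F ybar xs <=
    Dy ^+ 2 / (s * (t%:R + 2)) + L * Dx ^+ 2 / (t%:R + 2)
    + 4 * lam * Dy ^+ 2 / (mu * (t%:R + 2))
    + \sum_(k < t.+1) alpha k * dotv (zeta k) (xs - x k)
    + 4 / (mu * ((t%:R + 1) * (t%:R + 2))) * \sum_(k < t.+1) dotv (zeta k) (zeta k).
Proof.
move=> cX hDx cY hDy hlam clf gL L0 mu0 sc s0 Xxs Yys Xx Yy hy hx alpha xbar ybar.
have t1 : 0 < t%:R + 1 :> R by rewrite ltr_wpDl.
have t2 : 0 < t%:R + 2 :> R by rewrite ltr_wpDl.
have T0 : 0 < (t%:R + 1) * (t%:R + 2) :> R by rewrite mulr_gt0.
have alpha_gt0 k : 0 < alpha k.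
  by rewrite divr_gt0// mulr_gt0// ltr_wpDl.
have sum_alpha : \sum_(k < t.+1) alpha k = 1.
  rewrite -mulr_suml -mulr_sumr sum_succ -natr1.
  by field; rewrite !gt_eqF//; lra.
have [Xbar lfbar] := convex_fun_jensen t (u := fun k => x k.+1) cX clf
  (fun k => ltW (alpha_gt0 k)) (alpha_gt0 0%N) (fun k => Xx k.+1).
rewrite sum_alpha invr1 scale1r -/xbar mul1r in Xbar lfbar.
split=> //.
pose gap k := saddleP lf F ys (x k.+1) - saddleP lf F (y k.+1) xs.
have gapbar : saddleP lf F ys xbar - saddleP lf F ybar xs <=
    2 / ((t%:R + 1) * (t%:R + 2)) * \sum_(k < t.+1) (k%:R + 1) * gap k.
  have -> : 2 / ((t%:R + 1) * (t%:R + 2)) * \sum_(k < t.+1) (k%:R + 1) * gap k =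
      \sum_(k < t.+1) alpha k * gap k.
    by rewrite mulr_sumr; apply: eq_bigr => k _; rewrite /alpha; ring.
  have -> : saddleP lf F ybar xs = \sum_(k < t.+1) alpha k * saddleP lf F (y k.+1) xs.
    under eq_bigr => k _ do rewrite /saddleP mulrDr -dotvZl.
    by rewrite big_split/= -mulr_suml sum_alpha mul1r -dotv_suml.
  have -> : \sum_(k < t.+1) alpha k * gap k =
      \sum_(k < t.+1) alpha k * saddleP lf F ys (x k.+1)
      - \sum_(k < t.+1) alpha k * saddleP lf F (y k.+1) xs.
    by rewrite -sumrB; apply: eq_bigr => k _; rewrite mulrBr.
  rewrite lerD2r.
  under eq_bigr => k _ do rewrite /saddleP mulrDr dotv_mulmxr dotvC -dotvZl.
  by rewrite big_split/= /saddleP dotv_mulmxr dotvC -dotv_suml lerD2r.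
apply: (le_trans gapbar).
have D2 n (u v : 'cV[R]_n) D : enorm (u - v) <= D -> 0 <= dotv (u - v) (u - v) <= D ^+ 2.
  by move=> h; rewrite dotv_ge0 -enorm_leP// (le_trans (enorm_ge0 _) h).
have lamD0 : 0 <= lam * Dy ^+ 2 by rewrite mulr_ge0 ?(lambda_max_ge0 hlam)// sqr_ge0.
have := @weighted_telescope R gap (fun k => dotv (x k - xs) (x k - xs))
  (fun k => dotv (y k - ys) (y k - ys)) (fun k => dotv (zeta k) (xs - x k))
  (fun k => dotv (zeta k) (zeta k)) L mu s (Dx ^+ 2) (Dy ^+ 2) (lam * Dy ^+ 2)
  L0 mu0 s0 lamD0 (fun k => D2 _ _ _ _ (hDx _ _ (Xx k) Xxs))
  (fun k => D2 _ _ _ _ (hDy _ _ (Yy k) Yys)) (fun k => dotv_ge0 _).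
move=> /(_ _ t.+1) tel.
have C0 : 0 <= 2 / ((t%:R + 1) * (t%:R + 2)) :> R by rewrite divr_ge0 ?(ltW T0).
apply: (le_trans (ler_wpM2l C0 (tel _))) => [k|].
  have c0 : 0 < mu * (k%:R + 2) by rewrite mulr_gt0// ltr_wpDl.
  apply: (primal_dual_step cX cY hlam gL L0 mu0 sc s0 c0 (Xx k) Xxs Yys
    (hDy _ _ Yys (Yy k.+1)) (Yy k.+1) (hy k) (Xx k.+1)).
  have := hx k; have -> // : 2 / (mu * (k%:R + 2) + 2 * L) = (mu * (k%:R + 2) / 2 + L)^-1.
  by field; rewrite !gt_eqF//; lra.
rewrite [leLHS](_ : _ = Dy ^+ 2 / (s * (t%:R + 2)) + L * Dx ^+ 2 / (t%:R + 2)
    + 4 * lam * Dy ^+ 2 / (mu * (t%:R + 2))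
    + (2 / ((t%:R + 1) * (t%:R + 2)) * \sum_(k < t.+1) (k%:R + 1) * dotv (zeta k) (xs - x k))
    + 4 / (mu * ((t%:R + 1) * (t%:R + 2))) * \sum_(k < t.+1) dotv (zeta k) (zeta k)); last first.
  by rewrite -(natr1 t); field; rewrite !gt_eqF.
rewrite lerD2r lerD2l mulr_sumr le_eqVlt; apply/orP; left; apply/eqP.
by apply: eq_bigr => k _; rewrite /alpha; ring.
Qed.

(** * Measurability *)

(** Measurability of random vectors is expressed by coordinates, which avoids a sigma-algebra on
    ['cV]. The open set where [f > a] is the union of the rational boxes it contains, and these are
    countably many. *)
Lemma measurable_continuous_coord (R : realType) (d : measure_display)
  (T : measurableType d) n (f : 'cV[R]_n -> R) (u : T -> 'cV[R]_n) :
  continuous f -> (forall i, measurable_fun setT (fun w => u w i 0)) ->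
  measurable_fun setT (fun w => f (u w)).
Proof.
move=> cf mu.
apply: (measurability _ (RGenOInfty.measurableE R)) => _ [_ [a ->] <-].
rewrite setTI.
pose good (qr : 'cV[rat]_n * rat) :=
  forall v : 'cV[R]_n, (forall i, `|v i 0 - ratr (qr.1 i 0)| < ratr qr.2) -> a < f v.
(* Boxes that are not [good] contribute the empty set, so that the union runs over a whole countable
   type. *)
pose B (qr : 'cV[rat]_n * rat) : set T := if `[< good qr >]
  then \bigcap_(i in [set: 'I_n]) [set w | `|u w i 0 - ratr (qr.1 i 0)| < ratr qr.2]
  else set0.
have -> : (fun w => f (u w)) @^-1` `]a, +oo[%classic = \bigcup_qr B qr.
  apply/seteqP; split => w /=.
    rewrite in_itv/= andbT => afw.
    have : nbhs (u w) [set v | a < f v].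
      by apply: (cf (u w) [set z | a < z]); apply: open_nbhs_nbhs; split; [exact: open_gt|].
    move=> /nbhs_ballP[e /= e0 ball_e].
    (* Half of [e], because a point of the box is within [r] of the rational center, which is itself
       within [r] of [u w]. *)
    have [r] := rat_in_itvoo (divr_gt0 e0 (ltr0n R 2) : 0 < e / 2).
    rewrite in_itv/= => /andP[r0 re].
    have qP i : exists q : rat, `|u w i 0 - ratr q| < ratr r.
      have [|q] := @rat_in_itvoo R (u w i 0 - ratr r) (u w i 0 + ratr r); first lra.
      rewrite in_itv/= => /andP[q1 q2]; exists q.
      by rewrite ltr_norml; apply/andP; split; lra.
    have [q hq] := choice qP.
    exists (\col_i q i, r) => //; rewrite /B asboolT => [i _ /=|]; first by rewrite mxE.
    move=> v hv; apply: ball_e; split=> // i j; rewrite ord1 /ball/=.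
    have := hv i; have := hq i; rewrite mxE !ltr_norml => /andP[? ?] /andP[? ?].
    by apply/andP; split; lra.
  move=> [qr _]; rewrite /B; case: asboolP => // gqr Bw.
  by rewrite in_itv/= andbT; apply: gqr => i; exact: Bw.
apply: countable_bigcupT_measurable => [|qr]; first exact: countableP.
rewrite /B; case: asboolP => // _.
apply: fin_bigcap_measurable => // i _.
have mf : measurable_fun setT (fun w => `|u w i 0 - ratr (qr.1 i 0)|).
  by apply: measurableT_comp => //; apply: measurable_funB.
have := mf measurableT `]-oo, (ratr qr.2)[%classic (measurable_itv _).
by rewrite setTI; congr measurable; apply/seteqP; split => w /=; rewrite in_itv.
Qed.

Lemma measurable_dotv (R : realType) (d : measure_display) (T : measurableType d)
  n (u v : T -> 'cV[R]_n) :
  (forall i, measurable_fun setT (fun w => u w i 0)) ->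
  (forall i, measurable_fun setT (fun w => v w i 0)) ->
  measurable_fun setT (fun w => dotv (u w) (v w)).
Proof.
by move=> mu mv; apply: measurable_sum => i; exact: measurable_funM.
Qed.

Lemma measurable_mulmx_coord (R : realType) (d : measure_display)
  (T : measurableType d) m n (F : 'M[R]_(m, n)) (u : T -> 'cV[R]_n) :
  (forall i, measurable_fun setT (fun w => u w i 0)) ->
  forall i, measurable_fun setT (fun w => (F *m u w) i 0).
Proof.
move=> mu i; under eq_fun do rewrite mxE.
by apply: measurable_sum => j; apply: measurable_funM.
Qed.

Lemma measurable_addv_coord (R : realType) (d : measure_display)
  (T : measurableType d) n (u v : T -> 'cV[R]_n) :
  (forall i, measurable_fun setT (fun w => u w i 0)) ->
  (forall i, measurable_fun setT (fun w => v w i 0)) ->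
  forall i, measurable_fun setT (fun w => (u w + v w) i 0).
Proof.
by move=> mu mv i; under eq_fun do rewrite mxE; exact: measurable_funD.
Qed.

Lemma measurable_scalev_coord (R : realType) (d : measure_display)
  (T : measurableType d) n (a : R) (u : T -> 'cV[R]_n) :
  (forall i, measurable_fun setT (fun w => u w i 0)) ->
  forall i, measurable_fun setT (fun w => (a *: u w) i 0).
Proof.
by move=> mu i; under eq_fun do rewrite mxE; exact: measurable_funM.
Qed.

Lemma measurable_superlevel (R : realType) (d : measure_display)
  (T : measurableType d) (f : T -> R) (b : R) :
  measurable_fun setT f -> measurable [set w | b < f w].
Proof.
move=> mf; have := mf measurableT `]b, +oo[%classic (measurable_itv _).
by rewrite setTI; congr measurable; apply/seteqP; split => w /=; rewrite in_itv/= andbT.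
Qed.

(** * Exponential inequalities *)

Lemma expR_le_inv (R : realType) (u : R) : u < 1 -> expR u <= (1 - u)^-1.
Proof.
move=> u1; rewrite -[u]opprK expRN lef_pV2 ?posrE ?expR_gt0 ?subr_gt0 ?opprK//.
exact: expR_ge1Dx.
Qed.

(* For [0 <= x < 1], writing [u = x - x ^ 2], one has
   [expR x - expR (x ^ 2) = expR (x ^ 2) * (expR u - 1)
    <= (1 - x ^ 2)^-1 * (u / (1 - u)) = x / (1 + x ^ 3)]. *)
Lemma expR_le_addr_expR_sqr (R : realType) (x : R) : expR x <= x + expR (x ^+ 2).
Proof.
have [x0|x0] := ltP x 0.
  have h := expR_le_inv (lt_trans x0 ltr01).
  have h2 := expR_ge1Dx (x ^+ 2).
  have : (1 - x)^-1 <= 1 + x + x ^+ 2.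
    rewrite -[leLHS]mul1r ler_pdivrMr; last lra.
    have : 0 <= (- x) ^+ 3 by rewrite exprn_ge0// oppr_ge0 ltW.
    lra.
  lra.
have [x1|x1] := ltP x 1; last first.
  rewrite (@le_trans _ _ (expR (x ^+ 2)))//; last by rewrite lerDr.
  by rewrite ler_expR expr2 ler_peMr.
have h1 := @expR_le_inv _ (x ^+ 2) _; have h2 := @expR_le_inv _ (x - x ^+ 2) _.
have x21 : x ^+ 2 < 1 by rewrite expr_lt1.
have u1 : x - x ^+ 2 < 1 by have := sqr_ge0 x; lra.
have {}h1 := h1 x21; have {}h2 := h2 u1.
have -> : expR x = expR (x ^+ 2) * expR (x - x ^+ 2) by rewrite -expRD addrC subrK.
rewrite -lerBlDr -{2}[expR (x ^+ 2)]mulr1 -mulrBr.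
have h3 : expR (x - x ^+ 2) - 1 <= (x - x ^+ 2) / (1 - (x - x ^+ 2)).
  rewrite lerBlDr (le_trans h2)// le_eqVlt; apply/orP; left; apply/eqP; field; lra.
have x20 : 0 <= x - x ^+ 2 by rewrite subr_ge0 expr2 ler_piMr// ltW.
have h4 : 0 <= expR (x - x ^+ 2) - 1 by rewrite subr_ge0 -expR0 ler_expR.
rewrite (le_trans (ler_pM (expR_ge0 _) h4 h1 h3))//.
have -> : (1 - x ^+ 2)^-1 * ((x - x ^+ 2) / (1 - (x - x ^+ 2))) = x / (1 + x ^+ 3).
  have x30 : 0 <= x ^+ 3 by rewrite exprn_ge0.
  field; apply/and3P; split; rewrite gt_eqF//; lra.
by rewrite ler_pdivrMr ?ltr_pwDl ?exprn_ge0// ler_peMr// lerDl exprn_ge0.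
Qed.

Lemma expR_tangent (R : realType) (a m : R) : expR m * (1 + a - m) <= expR a.
Proof.
have -> : expR a = expR m * expR (a - m) by rewrite -expRD addrC subrK.
by rewrite ler_wpM2l ?expR_ge0// -addrA expR_ge1Dx.
Qed.

(** A pointwise form of Jensen's inequality for the power [p]: when [expR a] has mean at most
    [expR 1], integrating the right-hand side gives at most [expR p]. It is convexity of [expR]
    between [a - 1] and [0], obtained from tangents at [p * (a - 1)]. *)
Lemma expR_scale_le (R : realType) (p a : R) : 0 <= p <= 1 ->
  expR (p * a) <= expR p * (p * expR (a - 1) + (1 - p)).
Proof.
move=> /andP[p0 p1].
have -> : expR (p * a) = expR p * expR (p * (a - 1)) by rewrite -expRD; congr expR; ring.
rewrite ler_wpM2l ?expR_ge0//.
have h1 := ler_wpM2l p0 (expR_tangent (a - 1) (p * (a - 1))).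
have q0 : 0 <= 1 - p by rewrite subr_ge0.
have := ler_wpM2l q0 (expR_tangent 0 (p * (a - 1))).
rewrite expR0; lra.
Qed.

Lemma expR_mean_le (R : realType) n (a : 'I_n.+1 -> R) :
  expR (n.+1%:R^-1 * \sum_k a k) <= n.+1%:R^-1 * \sum_k expR (a k).
Proof.
set m := n.+1%:R^-1 * _.
rewrite ler_pdivlMl ?ltr0Sn//.
apply: (@le_trans _ _ (\sum_k expR m * (1 + a k - m))).
  rewrite -mulr_sumr sumrB big_split/= !sumr_const !card_ord -[m *+ _]mulr_natl /m mulrA.
  by rewrite divff// mul1r addrK mulrC.
by apply: ler_sum => k _; exact: expR_tangent.
Qed.

(** * Independence and conditioning on the past *)

Lemma chernoff_expR (R : realType) (d : measure_display) (T : measurableType d)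
  (P : probability T R) (Z : T -> R) (a c : R) : measurable_fun setT Z ->
  (\int[P]_w (expR (Z w))%:E <= c%:E)%E ->
  (P [set w | (a < Z w)%R] <= (c * expR (- a))%:E)%E.
Proof.
move=> mZ hZ.
pose Y := mfun_Sub (mem_set mZ : Z \in mfun).
have mge : measurable [set w | (a <= Z w)%R].
  have := mZ measurableT `[a, +oo[%classic (measurable_itv _).
  by rewrite setTI; congr measurable; apply/seteqP; split => w /=; rewrite in_itv/= andbT.
have mgt := measurable_superlevel a mZ.
apply: (@le_trans _ _ (P [set w | (a <= Z w)%R])).
  by apply: le_measure; rewrite ?inE// => w /= /ltW.
(* The parameter is [1]: any scaling is already inside [Z]. *)
apply: (le_trans (chernoff (P := P) Y a ltr01)).
rewrite mul1r EFinM lee_wpmul2r ?lee_fin ?expR_ge0//.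
rewrite /mmt_gen_fun unlock; apply: le_trans hZ.
rewrite le_eqVlt; apply/orP; left; apply/eqP.
by apply: eq_integral => w _ /=; rewrite mulr1.
Qed.

(** The product formula on rectangles determines the joint law of [(h, v)]. Keeping [f] nonnegative
    stays within Tonelli's theorem, and the inner integral plays the part of a conditional
    expectation. *)
Lemma integral_independent (R : realType) (d1 dO dX : measure_display)
  (T1 : measurableType d1) (Om : measurableType dO) (Xi : measurableType dX)
  (P : probability Om R) (Q : probability Xi R) (h : Om -> T1) (v : Om -> Xi) :
  measurable_fun setT h -> measurable_fun setT v ->
  (forall A B, measurable A -> measurable B ->
     P (h @^-1` A `&` v @^-1` B) = (P (h @^-1` A) * Q B)%E) ->
  forall f : T1 * Xi -> \bar R, measurable_fun setT f -> (forall z, 0 <= f z)%E ->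
  (\int[P]_w f (h w, v w) = \int[P]_w \int[Q]_e f (h w, e))%E.
Proof.
move=> mh mv ind f mf f0.
pose H := mfun_Sub (mem_set mh : h \in mfun).
have mhv : measurable_fun setT (fun w => (h w, v w)) by exact: measurable_fun_pair.
pose HV := mfun_Sub (mem_set mhv : _ \in mfun).
transitivity (\int[distribution P HV]_z f z)%E.
  by rewrite ge0_integral_pushforward.
transitivity (\int[distribution P H \x Q]_z f z)%E.
  apply: eq_measure_integral => A mA _; symmetry.
  by apply: product_measure_unique => // B C mB mC; exact: ind.
rewrite fubini_tonelli1// ge0_integral_pushforward//.
  exact: measurable_fun_fubini_tonelli_F.
by move=> z _; apply: integral_ge0.
Qed.

(** These are only the cylinders over the first [k] samples, a pi-system generating the past.
    Families [A] indexed by all of [nat], read below [k], make intersections pointwise. *)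
Definition past (Om Xi : Type) (S : set (set Xi)) (xi : nat -> Om -> Xi) (k : nat) :
    set (set Om) :=
  [set E | exists2 A : nat -> set Xi, (forall i, S (A i)) &
           E = \bigcap_(i in [set j | (j < k)%N]) xi i @^-1` A i].

(** The carrier is still [Om], with the sigma-algebra of the first [k] samples, so that depending on
    the past is plain measurability on this type. *)
Notation past_type xi k := (g_sigma_algebraType (past measurable xi k)).

Lemma past_setI_closed (dX : measure_display) (Om : Type) (Xi : measurableType dX)
  (xi : nat -> Om -> Xi) k : setI_closed (past measurable xi k).
Proof.
move=> _ _ [A mA ->] [B mB ->]; exists (fun i => A i `&` B i).
  by move=> i; exact: measurableI.
by rewrite -bigcapI.
Qed.

Lemma past_setT (dX : measure_display) (Om : Type) (Xi : measurableType dX)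
  (xi : nat -> Om -> Xi) k : past measurable xi k setT.
Proof. by exists (fun=> setT) => //; rewrite bigcapT. Qed.

Lemma past_subS (dX : measure_display) (Om : Type) (Xi : measurableType dX)
  (xi : nat -> Om -> Xi) k : past measurable xi k `<=` past measurable xi k.+1.
Proof.
move=> _ [A mA ->]; exists (fun i => if (i < k)%N then A i else setT).
  by move=> i; case: ifP.
apply/seteqP; split=> w /= Aw i /= ik.
  by case: ifPn => // ik'; exact: Aw.
by have := Aw i (ltnW ik : (i < k.+1)%N); rewrite /= ik.
Qed.

Lemma past_measurable (dO dX : measure_display) (Om : measurableType dO)
  (Xi : measurableType dX) (xi : nat -> Om -> Xi) k :
  (forall i, measurable_fun setT (xi i)) ->
  <<s past measurable xi k >> `<=` (@measurable _ Om).
Proof.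
move=> mxi; apply: smallest_sub; first exact: sigma_algebra_measurable.
move=> _ [A mA ->]; apply: bigcap_measurableType => i _.
by rewrite -[X in measurable X]setTI; exact: mxi.
Qed.

Lemma past_measurable_fun (dO dX d : measure_display) (Om : measurableType dO)
  (Xi : measurableType dX) (T : measurableType d) (xi : nat -> Om -> Xi) k
  (f : Om -> T) : (forall i, measurable_fun setT (xi i)) ->
  measurable_fun setT (f : past_type xi k -> T) -> measurable_fun setT f.
Proof.
move=> mxi mf _ B mB; have := mf measurableT B mB.
exact: past_measurable.
Qed.

Lemma past_measurable_funS (dO dX d : measure_display) (Om : measurableType dO)
  (Xi : measurableType dX) (T : measurableType d) (xi : nat -> Om -> Xi) k
  (f : Om -> T) : measurable_fun setT (f : past_type xi k -> T) ->
  measurable_fun setT (f : past_type xi k.+1 -> T).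
Proof.
move=> mf _ B mB; have := mf measurableT B mB.
apply: smallest_sub; first exact: smallest_sigma_algebra.
by move=> C /past_subS; exact: sub_sigma_algebra.
Qed.

Lemma past_measurable_sample (dO dX : measure_display) (Om : measurableType dO)
  (Xi : measurableType dX) (xi : nat -> Om -> Xi) k :
  measurable_fun setT (xi k : past_type xi k.+1 -> Xi).
Proof.
move=> _ B mB; rewrite setTI; apply: sub_sigma_algebra.
exists (fun i => if i == k then B else setT); first by move=> i; case: ifP.
apply/seteqP; split=> w /=.
  by move=> Bw i /= _; case: eqP => // ->.
by move=> /(_ k (ltnSn k)); rewrite /= eqxx.
Qed.

(** As functions of [A], both sides are finite measures on the past. They agree on cylinders by
    mutual independence, hence everywhere by uniqueness on a pi-system. *)
Lemma past_independent (R : realType) (dO dX : measure_display)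
  (Om : measurableType dO) (Xi : measurableType dX) (P : probability Om R)
  (muXi : probability Xi R) (xi : nat -> Om -> Xi) k (A : set Om) (B : set Xi) :
  mutually_independent P xi -> identically_distributed P xi muXi ->
  <<s past measurable xi k >> A -> measurable B ->
  P (A `&` xi k @^-1` B) = (P A * muXi B)%E.
Proof.
move=> ind idd pA mB.
have mxi i : measurable_fun setT (xi i) := (idd i).1.
have mV : measurable (xi k @^-1` B) by rewrite -[X in measurable X]setTI; apply: mxi.
have mid : measurable_fun setT (idfun : Om -> past_type xi k).
  by move=> _ C mC; rewrite setTI; exact: (@past_measurable _ _ _ _ xi k mxi C mC).
pose q := fine (muXi B).
have q0 : 0 <= q by apply: fine_ge0.
have qE : muXi B = q%:E by rewrite /q fineK//; exact: fin_num_measure.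
pose mid' := mfun_Sub (mem_set mid : _ \in mfun).
(* The existential hides the construction of the measure and keeps only its values. *)
have [m1 m1E] : exists m1 : measure (past_type xi k) R, forall C, m1 C = P (C `&` xi k @^-1` B).
  unshelve eexists; first by unshelve refine (pushforward (mrestr P mV)
    (idfun : Om -> past_type xi k) : measure (past_type xi k) R).
  by [].
pose m2 := mscale (NngNum q0) (distribution P mid').
suff : m1 A = m2 A.
  by rewrite m1E qE muleC.
apply: (@measure_unique _ R (past_type xi k) (past measurable xi k) (fun=> setT) erefl
  (@past_setI_closed _ _ _ xi k) (fun=> past_setT xi k)) => //.
- by rewrite bigcup_const.
- move=> C [D mD CE]; rewrite m1E CE.
  (* With [B] stored at index [k], one family describes both the cylinder and its intersection with
     the event on sample [k]; the two uses of independence then differ by the factor of index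
     [k]. *)
  pose D' i := if i == k then B else D i.
  have mD' i : measurable (D' i) by rewrite /D'; case: ifP.
  have iotaE n : [set j | j \in iota 0 n] = [set j | (j < n)%N].
    by apply/seteqP; split => j /=; rewrite mem_iota.
  have := ind (iota 0 k) D' (iota_uniq _ _) (fun i _ => mD' i).
  have := ind (iota 0 k.+1) D' (iota_uniq _ _) (fun i _ => mD' i).
  rewrite !iotaE -addn1 iotaD big_cat/= big_seq1 add0n => h1 h2.
  have E1 : \bigcap_(i in [set j | (j < k)%N]) xi i @^-1` D i =
            \bigcap_(i in [set j | (j < k)%N]) xi i @^-1` D' i.
    by apply: eq_bigcapr => i /= ik; rewrite /D' ltn_eqF.
  have E2 : \bigcap_(i in [set j | (j < k)%N]) xi i @^-1` D' i `&` xi k @^-1` B =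
            \bigcap_(i in [set j | (j < k + 1)%N]) xi i @^-1` D' i.
    rewrite addn1; apply/seteqP; split => w /=.
      move=> [Dw Bw] i /=; rewrite ltnS leq_eqVlt => /orP[/eqP->|]; last exact: Dw.
      by rewrite /D' eqxx.
    move=> Dw; split => [i /= ik|]; first exact/Dw/ltnW.
    by have := Dw k (ltnSn k); rewrite /D' /= eqxx.
  transitivity (q%:E * P (\bigcap_(i in [set j | (j < k)%N]) xi i @^-1` D i))%E => //.
  rewrite E1 E2 h1 h2 muleC; congr (_ * _)%E.
  by rewrite /D' eqxx (idd k).2.
- by move=> _; rewrite m1E setTI ltey_eq fin_num_measure.
Qed.

Lemma integral_past (R : realType) (dO dX : measure_display)
  (Om : measurableType dO) (Xi : measurableType dX) (P : probability Om R)
  (muXi : probability Xi R) (xi : nat -> Om -> Xi) k (f : past_type xi k * Xi -> \bar R) :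
  mutually_independent P xi -> identically_distributed P xi muXi ->
  measurable_fun setT f -> (forall z, 0 <= f z)%E ->
  (\int[P]_w f (w, xi k w) = \int[P]_w \int[muXi]_e f (w, e))%E.
Proof.
move=> ind idd mf f0.
have mxi i : measurable_fun setT (xi i) := (idd i).1.
apply: (@integral_independent _ _ _ _ (past_type xi k) _ _ P muXi idfun (xi k)) => //.
  by move=> _ C mC; rewrite setTI; exact: (@past_measurable _ _ _ _ xi k mxi C mC).
by move=> A B mA mB; exact: past_independent.
Qed.

(** * Sub-Gaussian moment bounds *)

(** The constants do not depend on [u] and [a], so the bound can be integrated: a zero mean kills
    [b * u], and a mean of [expR (a - 1)] at most [1] leaves [K <= expR p]. *)
Lemma subgaussian_pointwise (R : realType) (p : R) : 0 <= p ->
  exists b K q, [/\ 0 <= q <= 1, 0 <= K <= expR p & forall u a : R,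
    u ^+ 2 <= p * a -> expR u <= b * u + K * (q * expR (a - 1) + (1 - q))].
Proof.
move=> p0; have [p1|p1] := leP p 1.
  exists 1, (expR p), p; split; rewrite ?p0 ?p1 ?expR_ge0 ?lexx// => u a ua.
  rewrite mul1r (le_trans (expR_le_addr_expR_sqr u))// lerD2l.
  rewrite (@le_trans _ _ (expR (p * a)))// ?ler_expR//.
  by rewrite expR_scale_le ?p0.
(* By AM-GM, [u <= p / 2 + a / 2]; then [expR (a / 2)] is treated with the power [1 / 2], and
   [p / 2 + 1 / 2 <= p] since [p > 1]. *)
exists 0, (expR (p / 2) * expR 2^-1), 2^-1; split.
- by apply/andP; split; lra.
- by rewrite -expRD expR_ge0 ler_expR; lra.
move=> u a ua; rewrite mul0r add0r.
rewrite (@le_trans _ _ (expR (p / 2 + 2^-1 * a)))//.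
  rewrite ler_expR; have [u0|u0] := leP u 0; first by nra.
  have a0 : 0 <= a by nra.
  have : u ^+ 2 <= (p / 2 + 2^-1 * a) ^+ 2 by have := sqr_ge0 (p - a); nra.
  rewrite ler_pXn2r// ?nnegrE ?(ltW u0)//; lra.
rewrite (expRD (p / 2)) -[leRHS]mulrA ler_wpM2l ?expR_ge0// expR_scale_le//.
by apply/andP; split; lra.
Qed.

Lemma subgaussian_mgf (R : realType) (d : measure_display) (T : measurableType d)
  (Q : probability T R) (u a : T -> R) (p : R) : 0 <= p ->
  measurable_fun setT u -> measurable_fun setT a -> (forall e, 0 <= a e) ->
  (forall e, u e ^+ 2 <= p * a e) ->
  (\int[Q]_e (u e)%:E = 0)%E ->
  (\int[Q]_e (expR (a e))%:E <= (expR 1)%:E)%E ->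
  (\int[Q]_e (expR (u e))%:E <= (expR p)%:E)%E.
Proof.
move=> p0 mu ma a0 ua u0 ha.
have [b [K [q [/andP[q0 q1] /andP[K0 Kp] pw]]]] := subgaussian_pointwise p0.
have mea : measurable_fun setT (fun e => expR (a e)) by exact: measurableT_comp.
have ia : Q.-integrable setT (fun e => (expR (a e))%:E).
  apply/integrableP; split; first exact/measurable_EFinP.
  under eq_integral do rewrite /= ger0_norm ?expR_ge0//.
  by rewrite (le_lt_trans ha)// ltry.
(* Domination: [|u| <= u ^ 2 + 1 <= p * a + 1 <= (p + 1) * expR a]. *)
have iu : Q.-integrable setT (fun e => (u e)%:E).
  apply: (le_integrable _ _ _ (integrableZl measurableT (p + 1) ia)) => //.
    exact/measurable_EFinP.
  move=> e _; rewrite -EFinM !abse_EFin lee_fin.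
  rewrite [leRHS]ger0_norm ?mulr_ge0 ?expR_ge0//; last by lra.
  have h1 := expR_ge1Dx (a e).
  have : `|u e| <= u e ^+ 2 + 1.
    have := sqr_ge0 (`|u e| - 1); have := sqr_ge0 (u e).
    by have := real_normK (num_real (u e)); lra.
  have := ua e; have := a0 e; nra.
have ik c : Q.-integrable setT (fun=> c%:E) by exact: finite_measure_integrable_cst.
pose k1 := K * q * expR (- 1); pose k2 := K * (1 - q).
have k10 : 0 <= k1 by rewrite !mulr_ge0 ?expR_ge0.
apply: (@le_trans _ _ (\int[Q]_e ((b%:E * (u e)%:E + k1%:E * (expR (a e))%:E) + k2%:E))%E).
  apply: ge0_le_integral => //.
  - by apply/measurable_EFinP; exact: measurableT_comp.
  - by apply/measurable_EFinP; apply: measurable_funD => //; apply: measurable_funD;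
      exact: measurable_funM.
  move=> e _; rewrite -!EFinM -!EFinD lee_fin (le_trans (pw _ _ (ua e)))//.
  rewrite le_eqVlt; apply/orP; left; apply/eqP.
  by rewrite /k1 /k2 expRD; ring.
rewrite integralD//; last by apply: integrableD => //; exact: integrableZl.
rewrite integralD//; [|exact: integrableZl..].
rewrite !integralZl// u0 mule0 add0e integral_cst//.
rewrite [X in (k2%:E * X)%E]probability_setT mule1.
apply: (@le_trans _ _ (k1%:E * (expR 1)%:E + k2%:E)%E).
  by rewrite leeD2r// lee_wpmul2l.
rewrite -EFinM -EFinD lee_fin /k1 /k2 -!mulrA -expRD addNr expR0 mulr1 -mulrDr.
by rewrite (addrC q) subrK mulr1.
Qed.

Lemma oracle_mgf (R : realType) (dX : measure_display) (Xi : measurableType dX)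
  (Q : probability Xi R) n (g : Xi -> 'cV[R]_n) (m v : 'cV[R]_n) (sigma D c : R) :
  0 < sigma -> (forall i, measurable_fun setT (fun e => g e i 0)) ->
  (forall i, \int[Q]_e (g e i 0)%:E = (m i 0)%:E)%E ->
  (\int[Q]_e (expR (enorm (g e - m) ^+ 2 / sigma ^+ 2))%:E <= (expR 1)%:E)%E ->
  enorm v <= D ->
  (\int[Q]_e (expR (c * dotv (g e - m) v))%:E <= (expR (c ^+ 2 * (D ^+ 2 * sigma ^+ 2)))%:E)%E.
Proof.
move=> s0 mg gm hexp vD.
have s20 : 0 < sigma ^+ 2 by rewrite exprn_gt0.
have mz i : measurable_fun setT (fun e => (g e - m) i 0).
  exact: measurable_addv_coord.
pose a e := enorm (g e - m) ^+ 2 / sigma ^+ 2.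
have aE e : a e * sigma ^+ 2 = dotv (g e - m) (g e - m).
  by rewrite /a divfK ?gt_eqF// enorm_sqr.
have a0 e : 0 <= a e by rewrite divr_ge0 ?sqr_ge0.
have ma : measurable_fun setT a.
  rewrite /a; under eq_fun do rewrite enorm_sqr.
  by apply: measurable_funM => //; exact: measurable_dotv.
have mea : measurable_fun setT (fun e => expR (a e)) by exact: measurableT_comp.
have ia : Q.-integrable setT (fun e => (expR (a e))%:E).
  apply/integrableP; split; first exact/measurable_EFinP.
  under eq_integral do rewrite /= ger0_norm ?expR_ge0//.
  by rewrite (le_lt_trans hexp)// ltry.
have ik k : Q.-integrable setT (fun=> k%:E) by exact: finite_measure_integrable_cst.
(* The oracle is unbiased coordinate by coordinate; integrability of each coordinate is what allows
   summing these means into that of the inner product. *)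
have iz i : Q.-integrable setT (fun e => ((g e - m) i 0)%:E).
  apply: (le_integrable _ _ _ (integrableZl measurableT (sigma ^+ 2 + 1) ia)) => //.
    exact/measurable_EFinP.
  move=> e _; rewrite -EFinM !abse_EFin lee_fin.
  rewrite [leRHS]ger0_norm ?mulr_ge0 ?expR_ge0//; last by lra.
  apply: (le_trans (coord_le_enorm _ _)).
  have h1 := expR_ge1Dx (a e); have h2 := aE e; rewrite -enorm_sqr in h2.
  have := sqr_ge0 (enorm (g e - m) - 1); have := a0 e; nra.
have z0 i : (\int[Q]_e ((g e - m) i 0)%:E = 0)%E.
  have ig : Q.-integrable setT (fun e => (g e i 0)%:E).
    have -> : (fun e => (g e i 0)%:E) = (fun e => ((g e - m) i 0)%:E + (m i 0)%:E)%E.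
      by apply/funext => e; rewrite !mxE -EFinD subrK.
    exact: integrableD.
  under eq_integral do rewrite !mxE EFinB.
  rewrite integralB// gm integral_cst// [X in (_ * X)%E]probability_setT mule1.
  by rewrite -EFinB subrr.
(* Here [p = c ^ 2 * D ^ 2 * sigma ^ 2], and [u ^ 2 <= p * a] is Cauchy-Schwarz. *)
apply: (@subgaussian_mgf _ _ _ _ _ a) => //.
- by rewrite mulr_ge0 ?sqr_ge0// mulr_ge0// ?sqr_ge0.
- apply: measurable_funM => //; exact: measurable_dotv.
- move=> e; have -> : c ^+ 2 * (D ^+ 2 * sigma ^+ 2) * a e =
      c ^+ 2 * (D ^+ 2 * dotv (g e - m) (g e - m)) by rewrite -aE; ring.
  rewrite exprMn ler_wpM2l ?sqr_ge0//.
  have := ler_pM (normr_ge0 _) (normr_ge0 _) (dotv_norm_le (g e - m) v) (dotv_norm_le (g e - m) v).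
  rewrite -!expr2 real_normK ?num_real// exprMn enorm_sqr mulrC => /le_trans; apply.
  by rewrite ler_wpM2r ?dotv_ge0// ler_pXn2r ?nnegrE ?enorm_ge0// (le_trans (enorm_ge0 _) vD).
have -> : (fun e => (c * dotv (g e - m) v)%:E) =
    (fun e => \sum_i (c * v i 0)%:E * ((g e - m) i 0)%:E)%E.
  apply/funext => e; rewrite sumEFin -?EFinM /dotv mulr_sumr; congr EFin.
  by apply: eq_bigr => i _; rewrite mulrA mulrAC.
rewrite integral_sum//=; last by move=> i; exact: integrableZl.
by rewrite big1// => i _; rewrite integralZl// z0 mule0.
Qed.

(** * Noise along the trajectory *)

(** Joint measurability is phrased through composition with measurable arguments, again so as not to
    put a sigma-algebra on ['cV]. *)
Definition jointly_measurable (R : realType) (dX : measure_display)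
    (Xi : measurableType dX) n (G : 'cV[R]_n -> Xi -> 'cV[R]_n) : Prop :=
  forall (dT : measure_display) (T : measurableType dT) (u : T -> 'cV[R]_n) (v : T -> Xi),
    (forall i, measurable_fun setT (fun w => u w i 0)) -> measurable_fun setT v ->
    forall i, measurable_fun setT (fun w => G (u w) (v w) i 0).

(** Indices: [u k] may use the samples [xi 0, .., xi (k - 1)]; the sample [xi k] first enters
    [x k.+1]. *)
Definition adapted (R : realType) (dO dX : measure_display) (Om : measurableType dO)
    (Xi : measurableType dX) (xi : nat -> Om -> Xi) n (u : nat -> Om -> 'cV[R]_n) : Prop :=
  forall k i, measurable_fun setT ((fun w => u k w i 0) : past_type xi k -> R).

Definition noise (R : realType) (Om Xi : Type) n (G : 'cV[R]_n -> Xi -> 'cV[R]_n)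
    (gl : 'cV[R]_n -> 'cV[R]_n) (xi : nat -> Om -> Xi) (x : nat -> Om -> 'cV[R]_n)
    (k : nat) (w : Om) : 'cV[R]_n := G (x k w) (xi k w) - gl (x k w).

Lemma noise_measurable (R : realType) (dO dX : measure_display)
  (Om : measurableType dO) (Xi : measurableType dX) (xi : nat -> Om -> Xi) n
  (G : 'cV[R]_n -> Xi -> 'cV[R]_n) (gl : 'cV[R]_n -> 'cV[R]_n)
  (x : nat -> Om -> 'cV[R]_n) :
  jointly_measurable G -> adapted xi x -> adapted xi (fun k w => gl (x k w)) ->
  forall k i, measurable_fun setT
    ((fun w => noise G gl xi x k w i 0) : past_type xi k.+1 -> R).
Proof.
move=> mG mx mgl k i; rewrite /noise.
apply: (@measurable_addv_coord R _ (past_type xi k.+1)) => j.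
  apply: (mG _ (past_type xi k.+1)) => [l|]; last exact: past_measurable_sample.
  exact: past_measurable_funS.
under eq_fun do rewrite mxE.
apply: measurable_funN; exact: past_measurable_funS.
Qed.

(** With the first [m] samples frozen, the last exponential factor has mean at most a constant,
    which leaves the integral and multiplies the induction hypothesis. Measurability is proved in
    the same induction because [integral_past] requires the partial sum to depend on the past
    alone. *)
Lemma noise_sum_mgf (R : realType) (dO dX : measure_display)
  (Om : measurableType dO) (Xi : measurableType dX) (P : probability Om R)
  (muXi : probability Xi R) (xi : nat -> Om -> Xi) n (X : set 'cV[R]_n)
  (G : 'cV[R]_n -> Xi -> 'cV[R]_n) (gl : 'cV[R]_n -> 'cV[R]_n) (sigma D : R)
  (x : nat -> Om -> 'cV[R]_n) (xs : 'cV[R]_n) (alpha : nat -> R) (th : R) :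
  mutually_independent P xi -> identically_distributed P xi muXi ->
  jointly_measurable G -> adapted xi x -> adapted xi (fun k w => gl (x k w)) ->
  0 < sigma ->
  (forall z, X z -> forall i, (\int[muXi]_e (G z e i 0)%:E = (gl z i 0)%:E)%E) ->
  (forall z, X z ->
     (\int[muXi]_e (expR ((enorm (G z e - gl z)) ^+ 2 / sigma ^+ 2))%:E
        <= (expR 1)%:E)%E) ->
  (forall k w, X (x k w)) -> (forall k w, enorm (xs - x k w) <= D) ->
  forall m,
  measurable_fun setT ((fun w => \sum_(k < m) alpha k * dotv (noise G gl xi x k w) (xs - x k w))
    : past_type xi m -> R) /\
  (\int[P]_w (expR (th * \sum_(k < m) alpha k * dotv (noise G gl xi x k w) (xs - x k w)))%:E
     <= (expR (th ^+ 2 * (D ^+ 2 * sigma ^+ 2) * \sum_(k < m) alpha k ^+ 2))%:E)%E.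
Proof.
move=> ind idd mG mx mgl s0 Gm Gexp Xx xD.
have mxi i : measurable_fun setT (xi i) := (idd i).1.
have mdiff k : forall i, measurable_fun setT ((fun w => (xs - x k w) i 0) : past_type xi k -> R).
  move=> i; under eq_fun do rewrite 2!mxE.
  by apply: measurable_funB => //; exact: mx.
elim=> [|m [mS IH]].
  split; first by under eq_fun do rewrite big_ord0; exact: measurable_cst.
  under eq_integral do rewrite big_ord0 mulr0 expR0.
  rewrite big_ord0 mulr0 expR0 integral_cst// [X in (_ * X)%E]probability_setT.
  by rewrite mule1.
have mN i : measurable_fun setT
    ((fun w => noise G gl xi x m w i 0) : past_type xi m.+1 -> R).
  exact: noise_measurable.
split.
  under eq_fun do rewrite big_ord_recr/=.
  apply: measurable_funD; first exact: past_measurable_funS.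
  apply: measurable_funM => //.
  apply: (@measurable_dotv R _ (past_type xi m.+1)) => // i.
  exact: past_measurable_funS.
pose S w := \sum_(k < m) alpha k * dotv (noise G gl xi x k w) (xs - x k w).
pose f (z : past_type xi m * Xi) : \bar R :=
  (expR (th * S z.1) *
   expR (th * alpha m * dotv (G (x m z.1) z.2 - gl (x m z.1)) (xs - x m z.1)))%:E.
have mfst : measurable_fun setT (fst : past_type xi m * Xi -> past_type xi m).
  exact: measurable_fst.
have mf : measurable_fun setT f.
  apply/measurable_EFinP; apply: measurable_funM.
    apply: measurableT_comp => //; apply: measurable_funM => //.
    exact: (measurableT_comp mS mfst).
  apply: measurableT_comp => //; apply: measurable_funM => //.
  apply: measurable_dotv => i; last exact: (measurableT_comp (mdiff m i) mfst).
  under eq_fun do rewrite mxE; apply: measurable_funD.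
    apply: mG => [j|]; last exact: measurable_snd.
    exact: (measurableT_comp (mx m j) mfst).
  under eq_fun do rewrite mxE.
  by apply: measurable_funN; exact: (measurableT_comp (mgl m i) mfst).
have f0 z : (0 <= f z)%E by rewrite lee_fin mulr_ge0 ?expR_ge0.
have -> : (\int[P]_w (expR (th * \sum_(k < m.+1) alpha k *
      dotv (noise G gl xi x k w) (xs - x k w)))%:E = \int[P]_w f (w, xi m w))%E.
  apply: eq_integral => w _; rewrite big_ord_recr/= /f/= -expRD mulrDr.
  by rewrite -/(S w) !mulrA.
rewrite (integral_past ind idd mf f0).
have [c cE] : exists c, c = expR ((th * alpha m) ^+ 2 * (D ^+ 2 * sigma ^+ 2)) by eexists.
have c0 : (0 <= c%:E)%E by rewrite lee_fin cE expR_ge0.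
have mSO : measurable_fun setT (fun w => expR (th * S w)).
  apply: measurableT_comp => //; apply: measurable_funM => //.
  exact: (past_measurable_fun mxi mS).
have meS : measurable_fun setT (fun w => (expR (th * S w))%:E) by exact/measurable_EFinP.
have mcS := measurable_funeM c%:E meS.
apply: (@le_trans _ _ (\int[P]_w (c%:E * (expR (th * S w))%:E))%E).
  apply: ge0_le_integral => //.
  - by move=> w _; apply: integral_ge0.
  - apply: (past_measurable_fun mxi (k := m)).
    exact: measurable_fun_fubini_tonelli_F.
  move=> w _; rewrite /f/=; under eq_integral do rewrite EFinM.
  have mg i : measurable_fun setT (fun e => G (x m w) e i 0).
    by apply: mG => // j; exact: measurable_cst.
  have mE : measurable_fun setT (fun e => (expR (th * alpha m *
      dotv (G (x m w) e - gl (x m w)) (xs - x m w)))%:E).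
    apply/measurable_EFinP; apply: measurableT_comp => //; apply: measurable_funM => //.
    apply: measurable_dotv => // i.
    by under eq_fun do rewrite mxE; exact: measurable_funD.
  rewrite ge0_integralZl ?lee_fin ?expR_ge0//.
  rewrite muleC lee_wpmul2r ?lee_fin ?expR_ge0//.
  by rewrite cE; apply: oracle_mgf => //; [exact: Gm | exact: Gexp].
rewrite ge0_integralZl//.
apply: (@le_trans _ _ (c%:E * (expR (th ^+ 2 * (D ^+ 2 * sigma ^+ 2) * \sum_(k < m) alpha k ^+ 2))%:E)%E).
  by rewrite lee_wpmul2l.
rewrite -EFinM lee_fin cE -expRD ler_expR big_ord_recr/=; lra.
Qed.

Lemma noise_exp_moment (R : realType) (dO dX : measure_display)
  (Om : measurableType dO) (Xi : measurableType dX) (P : probability Om R)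
  (muXi : probability Xi R) (xi : nat -> Om -> Xi) n (X : set 'cV[R]_n)
  (G : 'cV[R]_n -> Xi -> 'cV[R]_n) (gl : 'cV[R]_n -> 'cV[R]_n) (sigma : R)
  (x : nat -> Om -> 'cV[R]_n) k :
  mutually_independent P xi -> identically_distributed P xi muXi ->
  jointly_measurable G -> adapted xi x -> adapted xi (fun k w => gl (x k w)) ->
  (forall z, X z ->
     (\int[muXi]_e (expR ((enorm (G z e - gl z)) ^+ 2 / sigma ^+ 2))%:E
        <= (expR 1)%:E)%E) ->
  (forall k w, X (x k w)) ->
  (\int[P]_w (expR (enorm (noise G gl xi x k w) ^+ 2 / sigma ^+ 2))%:E <= (expR 1)%:E)%E.
Proof.
move=> ind idd mG mx mgl Gexp Xx.
have mxi i : measurable_fun setT (xi i) := (idd i).1.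
pose f (z : past_type xi k * Xi) : \bar R :=
  (expR (enorm (G (x k z.1) z.2 - gl (x k z.1)) ^+ 2 / sigma ^+ 2))%:E.
have mfst : measurable_fun setT (fst : past_type xi k * Xi -> past_type xi k).
  exact: measurable_fst.
have mf : measurable_fun setT f.
  apply/measurable_EFinP; apply: measurableT_comp => //.
  apply: measurable_funM => //; under eq_fun do rewrite enorm_sqr.
  have mz i : measurable_fun setT (fun z : past_type xi k * Xi =>
      (G (x k z.1) z.2 - gl (x k z.1)) i 0).
    under eq_fun do rewrite mxE; apply: measurable_funD.
      apply: mG => [j|]; last exact: measurable_snd.
      exact: (measurableT_comp (mx k j) mfst).
    under eq_fun do rewrite mxE.
    by apply: measurable_funN; exact: (measurableT_comp (mgl k i) mfst).
  exact: measurable_dotv.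
have f0 z : (0 <= f z)%E by rewrite lee_fin expR_ge0.
rewrite (_ : (\int[P]_w _ = \int[P]_w f (w, xi k w))%E)//.
rewrite (integral_past ind idd mf f0).
apply: (@le_trans _ _ (\int[P]_w cst (expR 1)%:E w)%E).
  apply: ge0_le_integral => //.
  - by move=> w _; apply: integral_ge0.
  - apply: (past_measurable_fun mxi (k := k)).
    exact: measurable_fun_fubini_tonelli_F.
  by move=> w _; have := Gexp _ (Xx k w); rewrite /f.
by rewrite integral_cst// [X in (_ * X)%E]probability_setT mule1.
Qed.

(** * Projections and measurability of the iterates *)

Lemma projection_id (R : realType) n (X : set 'cV[R]_n) (p : 'cV[R]_n -> 'cV[R]_n) z :
  convex_set_cv X ->
  (forall z, X (p z) /\ forall v, X v -> enorm (z - p z) <= enorm (z - v)) ->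
  X z -> p z = z.
Proof.
move=> cX hp Xz; have [Xpz pzmin] := hp z.
apply: (projection_unique cX Xpz pzmin Xz) => v _.
by rewrite subrr enorm0 enorm_ge0.
Qed.

(** Composing with the nonexpansive [p] extends [f] from [X] to the whole space with the same
    Lipschitz constant. *)
Lemma projection_continuous (R : realType) n (X : set 'cV[R]_n)
  (p : 'cV[R]_n -> 'cV[R]_n) (f : 'cV[R]_n -> R) (C : R) :
  convex_set_cv X ->
  (forall z, X (p z) /\ forall v, X v -> enorm (z - p z) <= enorm (z - v)) ->
  0 <= C -> (forall u v, X u -> X v -> `|f u - f v| <= C * enorm (u - v)) ->
  continuous (fun z => f (p z)).
Proof.
move=> cX hp C0 fC; apply: (@enorm_lipschitz_continuous _ _ _ C) => u v.
have [[Xu hu] [Xv hv]] := (hp u, hp v).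
by rewrite (le_trans (fC _ _ Xu Xv))// ler_wpM2l// (projection_nonexpansive cX Xu hu Xv hv).
Qed.

Lemma measurable_lipschitz_on (R : realType) (dT : measure_display)
  (T : measurableType dT) n (X : set 'cV[R]_n) (f : 'cV[R]_n -> R) (C : R)
  (u : T -> 'cV[R]_n) :
  X !=set0 -> convex_set_cv X -> compact X -> 0 <= C ->
  (forall u v, X u -> X v -> `|f u - f v| <= C * enorm (u - v)) ->
  (forall w, X (u w)) -> (forall i, measurable_fun setT (fun w => u w i 0)) ->
  measurable_fun setT (fun w => f (u w)).
Proof.
move=> X0 cX kX C0 fC Xu mu; have [p hp] := projection_exists X0 kX.
have -> : (fun w => f (u w)) = fun w => f (p (u w)).
  by apply/funext => w; rewrite (projection_id cX hp).
apply: (measurable_continuous_coord (f := fun z => f (p z))) mu.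
exact: projection_continuous cX hp C0 fC.
Qed.

(** Here [q] is just some minimizer for each [w]; uniqueness identifies it with a fixed continuous
    function of [z w]. *)
Lemma measurable_projection_coord (R : realType) (dT : measure_display)
  (T : measurableType dT) n (X : set 'cV[R]_n) (z q : T -> 'cV[R]_n) :
  X !=set0 -> convex_set_cv X -> compact X ->
  (forall w, X (q w) /\ forall v, X v -> enorm (z w - q w) <= enorm (z w - v)) ->
  (forall i, measurable_fun setT (fun w => z w i 0)) ->
  forall i, measurable_fun setT (fun w => q w i 0).
Proof.
move=> X0 cX kX hq mz i; have [p hp] := projection_exists X0 kX.
have -> : (fun w => q w i 0) = fun w => p (z w) i 0.
  apply/funext => w; congr (fun_of_matrix _ i 0).
  have [[Xq hqw] [Xp hpw]] := (hq w, hp (z w)).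
  exact: (projection_unique cX Xq hqw Xp hpw).
apply: (measurable_continuous_coord (f := fun z => p z i 0)) mz.
apply: (projection_continuous (f := fun z => z i 0) cX hp ler01) => u v _ _.
by have := coord_le_enorm (u - v) i; rewrite !mxE mul1r.
Qed.

Lemma spdhg_adapted (R : realType) d l (X : set 'cV[R]_d) (Y : set 'cV[R]_l)
  (F : 'M[R]_(l, d)) (dO dX : measure_display) (Om : measurableType dO)
  (Xi : measurableType dX) (G : 'cV[R]_d -> Xi -> 'cV[R]_d) (s : R)
  (beta : nat -> R) (x0 : 'cV[R]_d) (y0 : 'cV[R]_l) (xi : nat -> Om -> Xi)
  (x : nat -> Om -> 'cV[R]_d) (y : nat -> Om -> 'cV[R]_l) :
  X !=set0 -> convex_set_cv X -> compact X ->
  Y !=set0 -> convex_set_cv Y -> compact Y -> jointly_measurable G ->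
  (forall w, x 0%N w = x0) -> (forall w, y 0%N w = y0) ->
  (forall k w, Y (y k.+1 w) /\ forall v, Y v ->
     enorm (y k w + s *: (F *m x k w) - y k.+1 w)
       <= enorm (y k w + s *: (F *m x k w) - v)) ->
  (forall k w,
     let z := x k w - beta k *: (G (x k w) (xi k w) + F^T *m y k.+1 w) in
     X (x k.+1 w) /\ forall v, X v -> enorm (z - x k.+1 w) <= enorm (z - v)) ->
  adapted xi x /\ adapted xi y.
Proof.
move=> X0 cX kX Y0 cY kY mG x00 y00 hy hx.
suff h k : (forall i, measurable_fun setT ((fun w => x k w i 0) : past_type xi k -> R)) /\
           (forall i, measurable_fun setT ((fun w => y k w i 0) : past_type xi k -> R)).
  by split=> k; have [] := h k.
elim: k => [|k [mx my]].
  by split=> i; [under eq_fun do rewrite x00 | under eq_fun do rewrite y00];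
    exact: measurable_cst.
have mxS i : measurable_fun setT ((fun w => x k w i 0) : past_type xi k.+1 -> R).
  exact: past_measurable_funS.
have myS i : measurable_fun setT ((fun w => y k w i 0) : past_type xi k.+1 -> R).
  exact: past_measurable_funS.
have my' : forall i, measurable_fun setT ((fun w => y k.+1 w i 0) : past_type xi k.+1 -> R).
  apply: (measurable_projection_coord (T := past_type xi k.+1) Y0 cY kY (hy k)).
  apply: (@measurable_addv_coord _ _ (past_type xi k.+1)) => //.
  apply: (@measurable_scalev_coord _ _ (past_type xi k.+1)).
  exact: (@measurable_mulmx_coord _ _ (past_type xi k.+1)).
split=> //.
apply: (measurable_projection_coord (T := past_type xi k.+1) X0 cX kX (hx k)).
apply: (@measurable_addv_coord _ _ (past_type xi k.+1)) => // i.
under eq_fun do rewrite -scaleNr.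
apply: (@measurable_scalev_coord _ _ (past_type xi k.+1)) => {}i.
apply: (@measurable_addv_coord _ _ (past_type xi k.+1)) => {}i.
  exact: (mG _ (past_type xi k.+1) (x k) (xi k) mxS (@past_measurable_sample _ _ _ _ xi k)).
exact: (@measurable_mulmx_coord _ _ (past_type xi k.+1)).
Qed.

(** * Concentration and conclusion *)

Lemma sum_weights_sqr_le (R : realType) t :
  \sum_(k < t.+1) (2 * (k%:R + 1) / ((t%:R + 1) * (t%:R + 2)) : R) ^+ 2
    <= 2 / (t%:R + 2).
Proof.
have t0 : 0 <= t%:R :> R by [].
rewrite (eq_bigr (fun k : 'I_t.+1 => (2 / ((t%:R + 1) * (t%:R + 2))) ^+ 2 * (k%:R + 1) ^+ 2));
  last by move=> k _; ring.
rewrite -mulr_sumr sum_succ_sqr -natr1.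
(* The last factor is at most [1], as [2 * t + 3 <= 3 * t + 3]. *)
rewrite [leLHS](_ : _ = 2 / (t%:R + 2) * ((2 * t%:R + 3) / (3 * (t%:R + 1)))); last first.
  by field; apply/andP; split; rewrite gt_eqF//; lra.
have h : 0 <= 2 / (t%:R + 2) :> R by rewrite divr_ge0// addr_ge0.
by rewrite ler_piMr// ler_pdivrMr; lra.
Qed.

Lemma martingale_tail (R : realType) (dO dX : measure_display)
  (Om : measurableType dO) (Xi : measurableType dX) (P : probability Om R)
  (muXi : probability Xi R) (xi : nat -> Om -> Xi) n (X : set 'cV[R]_n)
  (G : 'cV[R]_n -> Xi -> 'cV[R]_n) (gl : 'cV[R]_n -> 'cV[R]_n) (sigma D Omega : R)
  (x : nat -> Om -> 'cV[R]_n) (xs : 'cV[R]_n) (t : nat) :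
  mutually_independent P xi -> identically_distributed P xi muXi ->
  jointly_measurable G -> adapted xi x -> adapted xi (fun k w => gl (x k w)) ->
  0 < sigma ->
  (forall z, X z -> forall i, (\int[muXi]_e (G z e i 0)%:E = (gl z i 0)%:E)%E) ->
  (forall z, X z ->
     (\int[muXi]_e (expR ((enorm (G z e - gl z)) ^+ 2 / sigma ^+ 2))%:E
        <= (expR 1)%:E)%E) ->
  (forall k w, X (x k w)) -> (forall k w, enorm (xs - x k w) <= D) -> 0 <= D -> 0 < Omega ->
  let S w := \sum_(k < t.+1) 2 * (k%:R + 1) / ((t%:R + 1) * (t%:R + 2))
               * dotv (noise G gl xi x k w) (xs - x k w) in
  measurable_fun setT S /\
  (P [set w | (2 * Num.sqrt (2 * Omega) * D * sigma / Num.sqrt (t%:R + 2) < S w)%R]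
     <= (expR (- Omega))%:E)%E.
Proof.
move=> ind idd mG mx mgl s0 Gm Gexp Xx xD D0 Om0 S.
have mxi i : measurable_fun setT (xi i) := (idd i).1.
pose alpha (k : nat) : R := 2 * (k%:R + 1) / ((t%:R + 1) * (t%:R + 2)).
pose a := 2 * Num.sqrt (2 * Omega) * D * sigma / Num.sqrt (t%:R + 2).
pose V := D ^+ 2 * sigma ^+ 2 * (2 / (t%:R + 2)).
(* This [th] minimizes [th ^ 2 * V - th * a], whose minimum [- a ^ 2 / (4 * V)] equals [- Omega]
   because [a ^ 2 = 4 * Omega * V]. *)
pose th := a / (2 * V).
have [mS0 hS] := noise_sum_mgf alpha th ind idd mG mx mgl s0 Gm Gexp Xx xD t.+1.
have mS : measurable_fun setT S := past_measurable_fun mxi mS0.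
split=> //; rewrite -/a.
have t20 : 0 < t%:R + 2 :> R by rewrite ltr_wpDl.
have a2 : a ^+ 2 = 4 * Omega * V.
  rewrite /a /V !exprMn exprVn !sqr_sqrtr ?(ltW t20) ?mulr_ge0 ?(ltW Om0)//.
  by field; rewrite gt_eqF.
(* For [D = 0] the proxy [V] vanishes and [th] is a division by zero; but then [S] and [a] are both
   zero and the event is empty. *)
have [D00|Dn0] := eqVneq D 0.
  suff -> : [set w | (a < S w)%R] = set0 by rewrite measure0 lee_fin expR_ge0.
  apply/seteqP; split => w //=.
  have -> : a = 0 by rewrite /a D00 mulr0 !mul0r.
  rewrite /S big1 ?ltxx// => k _.
  have /eqP : xs - x k w = 0.
    apply: dotv_eq0; have := xD k w; rewrite D00 -enorm_sqr => h.
    have -> : enorm (xs - x k w) = 0 by apply/le_anti; rewrite h enorm_ge0.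
    by rewrite expr0n.
  move=> /eqP ->; rewrite -(scale0r (0 : 'cV[R]_n)) dotvZr mul0r mulr0 //.
have {}D0 : 0 < D by rewrite lt_neqAle eq_sym Dn0.
have V0 : 0 < V by rewrite mulr_gt0 ?divr_gt0// mulr_gt0 ?exprn_gt0.
have a0 : 0 < a by rewrite divr_gt0 ?mulr_gt0 ?sqrtr_gt0// mulr_gt0.
have th0 : 0 < th by rewrite divr_gt0// mulr_gt0.
have -> : [set w | (a < S w)%R] = [set w | (th * a < th * S w)%R].
  by apply/seteqP; split => w /=; rewrite ltr_pM2l.
have mthS : measurable_fun setT (fun w => th * S w) by exact: measurable_funM.
apply: (le_trans (chernoff_expR (th * a) mthS hS)).
rewrite lee_fin -expRD ler_expR.
have hV : D ^+ 2 * sigma ^+ 2 * \sum_(k < t.+1) alpha k ^+ 2 <= V.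
  by rewrite ler_wpM2l ?sum_weights_sqr_le// mulr_ge0 ?sqr_ge0.
have h1 : th ^+ 2 * (D ^+ 2 * sigma ^+ 2) * \sum_(k < t.+1) alpha k ^+ 2 <= th ^+ 2 * V.
  by rewrite -mulrA ler_wpM2l ?sqr_ge0.
have h2 : th ^+ 2 * V = Omega.
  by rewrite /th expr_div_n a2; field; rewrite gt_eqF.
have h3 : th * a = 2 * Omega.
  by rewrite /th mulrAC -expr2 a2; field; rewrite gt_eqF.
by rewrite h3; lra.
Qed.

Lemma noise_sqr_tail (R : realType) (dO dX : measure_display)
  (Om : measurableType dO) (Xi : measurableType dX) (P : probability Om R)
  (muXi : probability Xi R) (xi : nat -> Om -> Xi) n (X : set 'cV[R]_n)
  (G : 'cV[R]_n -> Xi -> 'cV[R]_n) (gl : 'cV[R]_n -> 'cV[R]_n) (sigma Omega : R)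
  (x : nat -> Om -> 'cV[R]_n) (t : nat) :
  mutually_independent P xi -> identically_distributed P xi muXi ->
  jointly_measurable G -> adapted xi x -> adapted xi (fun k w => gl (x k w)) ->
  (forall z, X z ->
     (\int[muXi]_e (expR ((enorm (G z e - gl z)) ^+ 2 / sigma ^+ 2))%:E
        <= (expR 1)%:E)%E) ->
  (forall k w, X (x k w)) ->
  let Z w := t.+1%:R^-1 * \sum_(k < t.+1) enorm (noise G gl xi x k w) ^+ 2 / sigma ^+ 2 in
  measurable_fun setT Z /\
  (P [set w | (1 + Omega < Z w)%R] <= (expR (- Omega))%:E)%E.
Proof.
move=> ind idd mG mx mgl Gexp Xx Z.
have mxi i : measurable_fun setT (xi i) := (idd i).1.
have mN k : measurable_fun setT (fun w => enorm (noise G gl xi x k w) ^+ 2 / sigma ^+ 2).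
  apply: measurable_funM => //; under eq_fun do rewrite enorm_sqr.
  by apply: measurable_dotv => i; apply: (past_measurable_fun mxi (k := k.+1));
    exact: noise_measurable.
have mZ : measurable_fun setT Z.
  by apply: measurable_funM => //; exact: measurable_sum.
split=> //.
have hZ : (\int[P]_w (expR (Z w))%:E <= (expR 1)%:E)%E.
  apply: (@le_trans _ _ (\int[P]_w (t.+1%:R^-1%:E * \sum_(k < t.+1)
     (expR (enorm (noise G gl xi x k w) ^+ 2 / sigma ^+ 2))%:E))%E).
    apply: ge0_le_integral => //.
    - by apply/measurable_EFinP; exact: measurableT_comp.
    - apply: measurable_funeM; apply: emeasurable_sum => k.
      by apply/measurable_EFinP; exact: measurableT_comp.
    by move=> w _; rewrite sumEFin -EFinM lee_fin; exact: expR_mean_le.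
  have me k : measurable_fun setT
      (fun w => (expR (enorm (noise G gl xi x k w) ^+ 2 / sigma ^+ 2))%:E).
    by apply/measurable_EFinP; exact: measurableT_comp.
  rewrite ge0_integralZl//; last 2 first.
  - by apply: emeasurable_sum => k; exact: me.
  - by move=> w _; apply: sume_ge0 => k _; rewrite lee_fin expR_ge0.
  rewrite ge0_integral_sum//.
  apply: (@le_trans _ _ (t.+1%:R^-1%:E * \sum_(k < t.+1) (expR 1)%:E)%E).
    rewrite lee_wpmul2l ?lee_fin ?invr_ge0//; apply: lee_sum => k _.
    exact: (noise_exp_moment k ind idd mG mx mgl Gexp Xx).
  rewrite sumEFin -EFinM lee_fin sumr_const card_ord -[expR 1 *+ _]mulr_natl mulrA.
  by rewrite mulVf// mul1r.
(* The [1] in the level [1 + Omega] absorbs the factor [expR 1] of the moment bound. *)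
apply: (le_trans (chernoff_expR (1 + Omega) mZ hZ)).
by rewrite lee_fin -expRD ler_expR; lra.
Qed.

Lemma spdhg_gap_tail (R : realType) (d l : nat)
  (X : set 'cV[R]_d) (Y : set 'cV[R]_l) (Dx Dy : R) (F : 'M[R]_(l, d))
  (lam : R) (lf : 'cV[R]_d -> R) (gl : 'cV[R]_d -> 'cV[R]_d) (L mu : R)
  (dO dX : measure_display) (Om : measurableType dO) (Xi : measurableType dX)
  (P : probability Om R) (muXi : probability Xi R)
  (G : 'cV[R]_d -> Xi -> 'cV[R]_d) (sigma : R)
  (s : R) (x0 : 'cV[R]_d) (y0 : 'cV[R]_l)
  (xi : nat -> Om -> Xi) (x : nat -> Om -> 'cV[R]_d) (y : nat -> Om -> 'cV[R]_l)
  (ys : 'cV[R]_l) (xs : 'cV[R]_d) (Omega : R) (t : nat) :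
  convex_set_cv X -> compact X -> (forall u v, X u -> X v -> enorm (u - v) <= Dx) ->
  convex_set_cv Y -> compact Y -> (forall u v, Y u -> Y v -> enorm (u - v) <= Dy) ->
  is_lambda_max (F^T *m F) lam ->
  convex_fun_on X lf -> grad_lipschitz_on X gl L -> 0 <= L ->
  0 < mu -> strongly_convex_on X lf gl mu ->
  0 < sigma -> jointly_measurable G ->
  (forall z, X z -> forall i, (\int[muXi]_e (G z e i 0)%:E = (gl z i 0)%:E)%E) ->
  (forall z, X z ->
     (\int[muXi]_e (expR ((enorm (G z e - gl z)) ^+ 2 / sigma ^+ 2))%:E
        <= (expR 1)%:E)%E) ->
  mutually_independent P xi -> identically_distributed P xi muXi ->
  0 < s -> X x0 -> Y y0 ->
  (forall w, x 0%N w = x0) -> (forall w, y 0%N w = y0) ->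
  (forall k w,
     Y (y k.+1 w) /\
     forall v, Y v ->
       saddleP lf F v (x k w) - (2 * s)^-1 * enorm (v - y k w) ^+ 2
       <= saddleP lf F (y k.+1 w) (x k w)
          - (2 * s)^-1 * enorm (y k.+1 w - y k w) ^+ 2) ->
  (forall k w,
     let beta := 2 / (mu * (k%:R + 2) + 2 * L) in
     let z := x k w - beta *: (G (x k w) (xi k w) + F^T *m y k.+1 w) in
     X (x k.+1 w) /\ forall v, X v -> enorm (z - x k.+1 w) <= enorm (z - v)) ->
  X xs -> Y ys -> 0 < Omega ->
  let alpha (k : nat) : R := 2 * (k%:R + 1) / ((t%:R + 1) * (t%:R + 2)) in
  let xbar w := \sum_(k < t.+1) alpha k *: x k.+1 w in
  let ybar w := \sum_(k < t.+1) alpha k *: y k.+1 w in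
  let bound : R :=
    Dy ^+ 2 / (s * (t%:R + 2)) + L * Dx ^+ 2 / (t%:R + 2)
    + 4 * lam * Dy ^+ 2 / (mu * (t%:R + 2))
    + 2 * Num.sqrt (2 * Omega) * Dx * sigma / Num.sqrt (t%:R + 2)
    + 4 * (1 + Omega) * sigma ^+ 2 / (mu * (t%:R + 2)) in
  (P [set w | saddleP lf F ys (xbar w) - saddleP lf F (ybar w) xs > bound]%R
     <= (2 * expR (- Omega))%:E)%E.
Proof.
move=> cX kX hDx cY kY hDy hlam clf gL L0 mu0 sc s0 mG Gm Gexp ind idd st0 Xx0 Yy0
  x00 y00 hy hx Xxs Yys Om0.
pose alpha (k : nat) : R := 2 * (k%:R + 1) / ((t%:R + 1) * (t%:R + 2)).
pose xbar w := \sum_(k < t.+1) alpha k *: x k.+1 w.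
pose ybar w := \sum_(k < t.+1) alpha k *: y k.+1 w.
pose bound : R :=
    Dy ^+ 2 / (s * (t%:R + 2)) + L * Dx ^+ 2 / (t%:R + 2)
    + 4 * lam * Dy ^+ 2 / (mu * (t%:R + 2))
    + 2 * Num.sqrt (2 * Omega) * Dx * sigma / Num.sqrt (t%:R + 2)
    + 4 * (1 + Omega) * sigma ^+ 2 / (mu * (t%:R + 2)).
change (P [set w | bound < saddleP lf F ys (xbar w) - saddleP lf F (ybar w) xs]%R
     <= (2 * expR (- Omega))%:E)%E.
have mxi i : measurable_fun setT (xi i) := (idd i).1.
have X0 : X !=set0 by exists x0.
have Y0 : Y !=set0 by exists y0.
have Xx k w : X (x k w) by case: k => [|k]; [rewrite x00 | exact: (hx k w).1].
have Yy k w : Y (y k w) by case: k => [|k]; [rewrite y00 | exact: (hy k w).1].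
have hyp k w : Y (y k.+1 w) /\ forall v, Y v ->
     enorm (y k w + s *: (F *m x k w) - y k.+1 w)
       <= enorm (y k w + s *: (F *m x k w) - v).
  by split; [exact: Yy | exact: dual_step_projection st0 (hy k w).2].
have [mx my] := spdhg_adapted (beta := fun k => 2 / (mu * (k%:R + 2) + 2 * L))
  X0 cX kX Y0 cY kY mG x00 y00 hyp hx.
have Dx0 : 0 <= Dx by rewrite (le_trans (enorm_ge0 _) (hDx _ _ Xx0 Xx0)).
have mgl : adapted xi (fun k w => gl (x k w)).
  move=> k i.
  apply: (@measurable_lipschitz_on R _ (past_type xi k) d X (fun z => gl z i 0) L (x k)) => //.
  move=> u v Xu Xv; have := coord_le_enorm (gl u - gl v) i; rewrite !mxE => /le_trans; apply.
  exact: gL.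
pose zeta := noise G gl xi x.
pose S w := \sum_(k < t.+1) alpha k * dotv (zeta k w) (xs - x k w).
pose Z w := t.+1%:R^-1 * \sum_(k < t.+1) enorm (zeta k w) ^+ 2 / sigma ^+ 2.
have [mS hS] : measurable_fun setT S /\ _ := martingale_tail t ind idd mG mx mgl s0 Gm
  Gexp Xx (fun k w => hDx _ _ Xxs (Xx k w)) Dx0 Om0.
have [mZ hZ] : measurable_fun setT Z /\ _ := noise_sqr_tail Omega t ind idd mG mx mgl Gexp Xx.
have gap w : X (xbar w) /\ saddleP lf F ys (xbar w) - saddleP lf F (ybar w) xs <=
    Dy ^+ 2 / (s * (t%:R + 2)) + L * Dx ^+ 2 / (t%:R + 2)
    + 4 * lam * Dy ^+ 2 / (mu * (t%:R + 2)) + S w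
    + 4 / (mu * ((t%:R + 1) * (t%:R + 2))) * \sum_(k < t.+1) dotv (zeta k w) (zeta k w).
  apply: (@primal_dual_gap R d l X Y Dx Dy F lam lf gl L mu s (fun k => x k w)
    (fun k => zeta k w) (fun k => y k w) ys xs t) => //.
    by move=> k; exact: (hyp k w).2.
  by move=> k; have [_] := hx k w; rewrite /zeta /noise [gl _ + _]addrC subrK.
have mO n (u : nat -> Om -> 'cV[R]_n) (mu' : adapted xi u) k i :
    measurable_fun setT (fun w => u k w i 0).
  exact: (past_measurable_fun mxi (mu' k i)).
have mbar n (u : nat -> Om -> 'cV[R]_n) (mu' : adapted xi u) i :
    measurable_fun setT (fun w => (\sum_(k < t.+1) alpha k *: u k.+1 w) i 0).
  under eq_fun do rewrite summxE.
  by apply: measurable_sum => k; apply: measurable_scalev_coord; exact: mO.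
have mgap : measurable_fun setT (fun w => saddleP lf F ys (xbar w) - saddleP lf F (ybar w) xs).
  apply: measurable_funB; apply: measurable_funD => //.
  (* Measurability of the event requires regularity of [lf]: the gradient is bounded by [C] on [X],
     and the first-order inequality turns this into a Lipschitz bound. *)
  - pose C := enorm (gl x0) + L * Dx.
    have glC u : X u -> enorm (gl u) <= C.
      move=> Xu; have -> : gl u = gl x0 + (gl u - gl x0) by rewrite addrC subrK.
      rewrite (le_trans (enorm_triangle _ _))// lerD2l (le_trans (gL _ _ Xu Xx0))//.
      by rewrite ler_wpM2l// hDx.
    have lfC u v : X u -> X v -> lf u - lf v <= C * enorm (u - v).
      move=> Xu Xv; have := sc _ _ Xu Xv; rewrite enorm_sqr.
      have h1 := CauchySchwarz_dotv (u - v) (gl u).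
      have h2 := ler_wpM2l (enorm_ge0 (u - v)) (glC _ Xu).
      have h3 : 0 <= mu / 2 * dotv (v - u) (v - u) by rewrite !mulr_ge0 ?dotv_ge0 ?(ltW mu0).
      rewrite -(opprB u v) [dotv (- (u - v)) (gl u)]dotvNl; rewrite -(opprB u v) in h3.
      by lra.
    apply: (@measurable_lipschitz_on R _ Om d X lf C) => //.
    + by rewrite addr_ge0 ?enorm_ge0 ?mulr_ge0.
    + move=> u v Xu Xv; rewrite ler_norml lfC// andbT lerNl opprB.
      by rewrite -(opprB v u) enormN lfC.
    + by move=> w; have [] := gap w.
    + exact: mbar.
  - by apply: measurable_dotv => //; apply: measurable_mulmx_coord; exact: mbar.
  - by apply: measurable_dotv => //; exact: mbar.
pose a := 2 * Num.sqrt (2 * Omega) * Dx * sigma / Num.sqrt (t%:R + 2).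
have t1 : 0 < t%:R + 1 :> R by rewrite ltr_wpDl.
have t2 : 0 < t%:R + 2 :> R by rewrite ltr_wpDl.
(* If neither deviation occurs, the deterministic estimate gives at most [bound]; the union of the
   two events accounts for the factor [2]. *)
have sub : [set w | (bound < saddleP lf F ys (xbar w) - saddleP lf F (ybar w) xs)%R]
    `<=` [set w | (a < S w)%R] `|` [set w | (1 + Omega < Z w)%R].
  move=> w /= bw; have [Sa|Sa] := ltP a (S w); [by left | right].
  rewrite ltNge; apply/negP => Zw.
  move: bw; apply/negP; rewrite -leNgt; apply: (le_trans (gap w).2).
  rewrite /bound -/a lerD//; first by rewrite lerD2l.
  have hZw : \sum_(k < t.+1) dotv (zeta k w) (zeta k w) = Z w * ((t%:R + 1) * sigma ^+ 2).
    rewrite /Z -mulr_suml -natr1.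
    under [in RHS]eq_bigr do rewrite enorm_sqr.
    by field; rewrite !gt_eqF.
  rewrite hZw [leLHS](_ : _ = Z w * (4 * sigma ^+ 2 / (mu * (t%:R + 2)))); last first.
    by field; rewrite !gt_eqF.
  rewrite [leRHS](_ : _ = (1 + Omega) * (4 * sigma ^+ 2 / (mu * (t%:R + 2)))); last by ring.
  rewrite ler_wpM2r// divr_ge0// mulr_ge0 ?sqr_ge0//; exact: ltW.
apply: (@le_trans _ _ (P ([set w | (a < S w)%R] `|` [set w | (1 + Omega < Z w)%R]))).
  apply: le_measure; rewrite ?inE//; first exact: measurable_superlevel.
  by apply: measurableU; exact: measurable_superlevel.
have -> : (2 * expR (- Omega))%:E = ((expR (- Omega))%:E + (expR (- Omega))%:E)%E.
  by rewrite -EFinD; congr EFin; ring.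
apply: (le_trans (measureU2 _ _ _)); [exact: measurable_superlevel..|].
exact: leeD.
Qed.

Unset Implicit Arguments.

Theorem theorem6 (R : realType) (d l : nat)
  (X : set 'cV[R]_d) (Y : set 'cV[R]_l) (Dx Dy : R) (F : 'M[R]_(l, d))
  (lam : R) (lf : 'cV[R]_d -> R) (gl : 'cV[R]_d -> 'cV[R]_d) (L mu : R)
  (dO dX : measure_display) (Om : measurableType dO) (Xi : measurableType dX)
  (P : probability Om R) (muXi : probability Xi R)
  (G : 'cV[R]_d -> Xi -> 'cV[R]_d) (sigma : R)
  (s : R) (x0 : 'cV[R]_d) (y0 : 'cV[R]_l)
  (xi : nat -> Om -> Xi) (x : nat -> Om -> 'cV[R]_d) (y : nat -> Om -> 'cV[R]_l)
  (ys : 'cV[R]_l) (xs : 'cV[R]_d) (Omega : R) (t : nat) :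
  (* sets *)
  X !=set0 -> convex_set_cv X -> compact X -> is_diameter X Dx ->
  Y !=set0 -> convex_set_cv Y -> compact Y -> is_diameter Y Dy ->
  is_lambda_max (F^T *m F) lam ->
  (* loss *)
  convex_fun_on X lf -> gradient_on X lf gl -> grad_lipschitz_on X gl L ->
  0 < mu -> strongly_convex_on X lf gl mu ->
  (* stochastic gradient oracle *)
  0 < sigma ->
  (forall (dT : measure_display) (T : measurableType dT)
          (u : T -> 'cV[R]_d) (v : T -> Xi),
     (forall i, measurable_fun setT (fun w => u w i 0)) ->
     measurable_fun setT v ->
     forall i, measurable_fun setT (fun w => G (u w) (v w) i 0)) ->
  (forall z, X z -> forall i,
     (\int[muXi]_e (G z e i 0)%:E = (gl z i 0)%:E)%E) ->
  (forall z, X z ->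
     (\int[muXi]_e ((enorm (G z e - gl z)) ^+ 2)%:E <= (sigma ^+ 2)%:E)%E) ->
  (forall z, X z ->
     (\int[muXi]_e (expR ((enorm (G z e - gl z)) ^+ 2 / sigma ^+ 2))%:E
        <= (expR 1)%:E)%E) ->
  (* i.i.d. samples; xi k is the sample used at iteration k *)
  mutually_independent P xi -> identically_distributed P xi muXi ->
  (* SPDHG *)
  0 < s -> X x0 -> Y y0 ->
  (forall w, x 0%N w = x0) -> (forall w, y 0%N w = y0) ->
  (forall k w,
     Y (y k.+1 w) /\
     forall v, Y v ->
       saddleP lf F v (x k w) - (2 * s)^-1 * enorm (v - y k w) ^+ 2
       <= saddleP lf F (y k.+1 w) (x k w)
          - (2 * s)^-1 * enorm (y k.+1 w - y k w) ^+ 2) ->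
  (forall k w,
     let beta := 2 / (mu * (k%:R + 2) + 2 * L) in
     let z := x k w - beta *: (G (x k w) (xi k w) + F^T *m y k.+1 w) in
     X (x k.+1 w) /\ forall v, X v -> enorm (z - x k.+1 w) <= enorm (z - v)) ->
  (* saddle point *)
  is_saddle_point X Y (saddleP lf F) ys xs ->
  0 < Omega ->
  let alpha (k : nat) : R := 2 * (k%:R + 1) / ((t%:R + 1) * (t%:R + 2)) in
  let xbar w := \sum_(k < t.+1) alpha k *: x k.+1 w in
  let ybar w := \sum_(k < t.+1) alpha k *: y k.+1 w in
  let bound : R :=
    Dy ^+ 2 / (s * (t%:R + 2)) + L * Dx ^+ 2 / (t%:R + 2)
    + 4 * lam * Dy ^+ 2 / (mu * (t%:R + 2))
    + 2 * Num.sqrt (2 * Omega) * Dx * sigma / Num.sqrt (t%:R + 2)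
    + 4 * (1 + Omega) * sigma ^+ 2 / (mu * (t%:R + 2)) in
  (P [set w | saddleP lf F ys (xbar w) - saddleP lf F (ybar w) xs > bound]%R
     <= (2 * expR (- Omega))%:E)%E.
Proof.
move=> X0 cX kX [hDx Dxmin] Y0 cY kY [hDy _] hlam clf _ gL mu0 sc s0 mG Gm _ Gexp ind idd
  st0 Xx0 Yy0 x00 y00 hy hx [Yys [Xxs _]] Om0.
(* Two distinct points of [X] force [mu <= L], hence the sign of [L] required above. *)
have [[u [v [Xu Xv uv]]]|sing] := pselect (exists u v, [/\ X u, X v & u != v]).
  have L0 : 0 <= L := le_trans (ltW mu0) (lipschitz_ge_strong_convexity gL sc Xu Xv uv).
  exact: (spdhg_gap_tail t cX kX hDx cY kY hDy hlam clf gL L0 mu0 sc s0 mG Gm Gexp ind idd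
    st0 Xx0 Yy0 x00 y00 hy hx Xxs Yys Om0).
have eqX u v : X u -> X v -> u = v.
  by move=> Xu Xv; apply: contrapT => /eqP uv; apply: sing; exists u, v.
(* On a singleton the constant [L] may be negative, but it is then irrelevant. *)
have Dx0 : Dx = 0.
  apply/le_anti; rewrite (le_trans (enorm_ge0 _) (hDx _ _ Xxs Xxs)) andbT Dxmin// => u v Xu Xv.
  by rewrite (eqX _ _ Xu Xv) subrr enorm0.
have gL0 : grad_lipschitz_on X gl 0.
  by move=> u v Xu Xv; rewrite (eqX _ _ Xu Xv) !subrr !enorm0 mulr0.
(* Replacing [L] by [0] changes the step-size, but every projection onto a singleton is the same
   point; with [Dx = 0] the two bounds coincide. *)
have hx0 k w : let beta := 2 / (mu * (k%:R + 2) + 2 * 0) in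
     let z := x k w - beta *: (G (x k w) (xi k w) + F^T *m y k.+1 w) in
     X (x k.+1 w) /\ forall v, X v -> enorm (z - x k.+1 w) <= enorm (z - v).
  have [Xk _] := hx k w; split=> // v Xv.
  by rewrite (eqX _ _ Xk Xv).
have := spdhg_gap_tail t cX kX hDx cY kY hDy hlam clf gL0 (lexx 0) mu0 sc s0 mG Gm Gexp
  ind idd st0 Xx0 Yy0 x00 y00 hy hx0 Xxs Yys Om0.
by rewrite Dx0 expr0n !mulr0.
Qed.
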